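(* There exists a finitely presented semigroup with zero $H$ which has the following properties: (i) there exists a nonnilpotent ideal $I=LH$, where $L$ is a letter in $H$; (ii) if a word $A\in H$ can be written as $A=XYYZ$, where $X,Y,Z\in H$, then $LA=0$.
   Context: A finitely presented semigroup with zero is a semigroup with zero element $0$ given by a finite alphabet of generators (called letters) and finitely many defining relations, each of the form $u=v$ or $u=0$ with $u,v$ words in the letters. Elements of $H$ are represented by words in the letters, and equalities between words are understood in $H$. The letter $L$ in (ii) is the same letter as in (i), and $LH=\{Lh : h\in H\}$.
   Formalization: ''Ideal'' is read as right ideal: if LH were a two-sided ideal, then h2 L h3 = Lc for some c, so L h1 L h2 L h3 = L h1 L L c = 0 by (ii), and LH would be nilpotent, contradicting (i). *)

(* Defs.v *)
From HB Require Import structures.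
From mathcomp Require Import all_boot.
From mathcomp Require Import boolp classical_sets.

Set Implicit Arguments.
Unset Strict Implicit.
Unset Printing Implicit Defensive.

Local Open Scope quotient_scope.
Local Open Scope group_scope.

HB.mixin Record hasZero G of Semigroup G := {
  szero : G;
  zero_mulg : forall x : G, szero * x = szero;
  mulg_zero : forall x : G, x * szero = szero
}.

#[short(type="semigroup0Type")]
HB.structure Definition Semigroup0 := {G of Semigroup G & hasZero G}.

Arguments szero {s}.

Section Ideals.
Variable H : semigroup0Type.
Implicit Type I J : set H.

(** One-sided on purpose: if L H were two-sided and L X Y Y Z = 0 for all X, Y, Z,
    then L h1 L h2 L h3 = L h1 L L c = 0, where h2 L h3 = L c, so (L H)^3 = 0. *)
Definition right_ideal I : Prop :=
  I szero /\ forall x h, I x -> I (x * h).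

Definition set_mulg I J : set H := [set x * y | x in I & y in J]%classic.

(** [iter n (fun J => set_mulg J I) I] is the power I^(n+1); there is no I^0,
    since H need not have an identity. *)
Definition nilpotent I : Prop :=
  exists n : nat, iter n (fun J => set_mulg J I) I = [set szero]%classic.

End Ideals.

(** A word is nonempty: semigroups have no empty product. *)
Record word (A : Type) := Word { letters :> seq A; _ : ~~ nilp letters }.

HB.instance Definition _ (A : Type) := [isSub for @letters A].
HB.instance Definition _ (A : choiceType) := [Choice of word A by <:].

Definition letter_word A (a : A) : word A := @Word A [:: a] isT.

Fact word_cat_subproof A (u v : word A) : ~~ nilp (u ++ v).
Proof. by rewrite /nilp size_cat addn_eq0 negb_and (valP u). Qed.

Definition word_cat A (u v : word A) : word A := Word (word_cat_subproof u v).

(** The free semigroup with zero on A is [option (word A)], where [None] is the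
    zero; a relation (u, Some v) stands for u = v and (u, None) for u = 0. *)
Record presentation := Presentation {
  alphabet : finType;
  relations : seq (word alphabet * option (word alphabet))
}.

Definition word0_mul A (x y : option (word A)) : option (word A) :=
  if x is Some u then if y is Some v then Some (word_cat u v) else None
  else None.

Section Presented.
Variable P : presentation.

Inductive pres_eq : option (word (alphabet P)) ->
    option (word (alphabet P)) -> Prop :=
| pres_rel r : r \in relations P -> pres_eq (Some r.1) r.2
| pres_refl x : pres_eq x x
| pres_sym x y : pres_eq x y -> pres_eq y x
| pres_trans y x z : pres_eq x y -> pres_eq y z -> pres_eq x z
| pres_mul x x' y y' : pres_eq x x' -> pres_eq y y' ->
    pres_eq (word0_mul x y) (word0_mul x' y').

Definition pres_eqb : rel (option (word (alphabet P))) :=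
  fun x y => `[< pres_eq x y >].

Fact pres_eqb_refl : reflexive pres_eqb.
Proof. by move=> x; apply/asboolP; exact: pres_refl. Qed.

Fact pres_eqb_sym : symmetric pres_eqb.
Proof.
by move=> x y; apply/asboolP/asboolP => h; exact: pres_sym.
Qed.

Fact pres_eqb_trans : transitive pres_eqb.
Proof.
move=> y x z /asboolP xy /asboolP yz; apply/asboolP; exact: pres_trans xy yz.
Qed.

Canonical pres_equiv := EquivRel pres_eqb pres_eqb_refl pres_eqb_sym
  pres_eqb_trans.

Definition presented : Type := {eq_quot pres_equiv}.

HB.instance Definition _ := Choice.on presented.
HB.instance Definition _ := EqQuotient.on presented.

Definition eval (x : option (word (alphabet P))) : presented :=
  \pi_presented x.

Lemma evalP x y : eval x = eval y <-> pres_eq x y.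
Proof. by split=> [/eqquotP/asboolP | /asboolP h]; last exact/eqquotP. Qed.

Definition presented_mul (a b : presented) : presented :=
  eval (word0_mul (repr a) (repr b)).

Lemma evalM x y : presented_mul (eval x) (eval y) = eval (word0_mul x y).
Proof.
by apply/evalP/pres_mul; apply/evalP; rewrite /eval reprK.
Qed.

Fact word0_mulA : associative (@word0_mul (alphabet P)).
Proof.
move=> [u|] [v|] [w|] //=; congr Some; apply: val_inj => /=; exact: catA.
Qed.

Lemma eval_repr (a : presented) : eval (repr a) = a.
Proof. exact: reprK. Qed.

Fact presented_mulA : associative presented_mul.
Proof.
move=> a b c; rewrite -[a]eval_repr -[b]eval_repr -[c]eval_repr.
by rewrite !evalM word0_mulA.
Qed.

HB.instance Definition _ := isSemigroup.Build presented presented_mulA.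

Fact presented_0mul (a : presented) : eval None * a = eval None.
Proof. by rewrite -[a]eval_repr; exact: evalM. Qed.

Fact presented_mul0 (a : presented) : a * eval None = eval None.
Proof.
by rewrite -[a]eval_repr; apply: etrans (evalM _ _) _; case: (repr a).
Qed.

HB.instance Definition _ :=
  hasZero.Build presented presented_0mul presented_mul0.

Definition gen (a : alphabet P) : presented := eval (Some (letter_word a)).

End Presented.

(* Main.v *)
Require Import Defs.
From HB Require Import structures.
From mathcomp Require Import all_boot.
From mathcomp Require Import zify.
From mathcomp Require Import boolp classical_sets.

Set Implicit Arguments.
Unset Strict Implicit.
Unset Printing Implicit Defensive.

(** The semigroup is a rewriting machine that searches its own words for
    squares.  The product of the words [Start Base x1], [Start Base x2], ...
    turns into a sequence of zones
    [Root x1 Front x1 Root x2 Front x2 ...], one for each colour.  A front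
    moves to the right through the cells that follow it and writes the code of
    each of them at the right end of the text of its own zone.  The machine of
    a zone is a head that scans the text, drops at arbitrary places a mark I
    and a mark J behind it, and then compares, symbol by symbol, the text that
    follows I with the text that follows J.  If I catches up with J, the text
    holds a square, and the word is declared to be 0.

    All moves are relations, so they can be undone; the dropping places are
    arbitrary, so every square of the text is found.  The symbols compared
    depend on a mode, fixed when I is dropped: either all of them, or only the
    colours (hats).  The code of the first cell of a zone carries the
    colour of the zone, so a text also records the colours of the zones that
    have been eaten.

    Nothing useful collapses.  Call a word legitimate for a sequence of colours
    [xs] if it is a possible stage of the computation that starts from
    [Start Base x1 Start Base x2 ...], in the sense of [legit].  The defining
    relations are all the relations u = v and u = 0 with words of length at most
    5 that respect legitimacy for every squarefree [xs] ([valid]); there are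
    finitely many of them, and legitimate words are nonzero by construction
    ([pres_eq_legit]).  In particular
    [Start Base x1 Start Base x2 ...] is nonzero when the colours come from an
    infinite squarefree sequence, such as one read off the 2-adic expansions of
    the integers ([ruler_squarefree]), so the right ideal is not nilpotent.
    What must be proved is that there are enough valid relations.  First, the
    moves of the machine are valid: [valid_move], [valid_start] and [valid_eat].
    Second, the relation that declares a found square to be 0 is valid, which
    says that no legitimate word contains one ([none_square]): the code
    preserves squarefreeness ([encode_squarefree]), so by induction all texts,
    and in fact all legitimate words ([legit_squarefree]), are squarefree.
    Third, short words that occur in no legitimate word are 0: these lemmas are
    called [none_...].

    Conversely let a word X Y Y Z be given after [Start] ([zero_square]).  The
    letters [Start] and [Base] are replaced by zones.  If Y has no front, the
    fronts before Y Y are pushed over it, and each of them turns a square of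
    cells into a square of symbols; the first zone then has a square in its text
    and its machine finds it in the mode that compares everything
    ([zero_repeated_cells]).  If Y has a front, the cells of the two copies may
    be cut differently by it, and only the sequence of the fronts is known to
    hold a square.  But every zone can be brought back to its initial state
    [Root g Front g], or else the word is 0 ([zero_zone]): the
    machine is run backwards, and the forbidden short words catch whatever is not
    a state of the machine.  Then all the fronts are pushed to the right, the
    first zone receives a text whose hats are the colours of all the other zones,
    and its machine, in the mode that compares hats only, finds the square
    ([zero_repeated_colours]).  This is why zones have colours and why each
    front has to agree with the root of its zone. *)

(** * Squarefree words *)

Lemma cat_injr (T : Type) (a b c : seq T) : a ++ c = b ++ c -> a = b.
Proof.
elim/last_ind: c a b => [|c x IH] a b; first by rewrite !cats0.
by rewrite -!rcons_cat => /rcons_inj [/IH].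
Qed.

Definition squarefree (T : Type) (s : seq T) :=
  forall p y q, s = p ++ y ++ y ++ q -> y = [::].

Lemma squarefree_infix (T : Type) (p s q : seq T) :
  squarefree (p ++ s ++ q) -> squarefree s.
Proof.
move=> sq p' y q' e; apply: (sq (p ++ p') y (q' ++ q)).
by rewrite e !catA.
Qed.

Lemma squarefree_pmap (S T : Type) (f : S -> option T) s p y q :
  squarefree (pmap f s) -> s = p ++ y ++ y ++ q -> pmap f y = [::].
Proof.
move=> sq e; apply: (sq (pmap f p) _ (pmap f q)).
by rewrite e !pmap_cat.
Qed.

Lemma squarefree_nth (T : Type) (x0 : T) (s : seq T) :
  (forall i n, 0 < n -> i + n + n <= size s ->
    exists2 t, t < n & nth x0 s (i + t) <> nth x0 s (i + n + t)) ->
  squarefree s.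
Proof.
move=> H p y q e; case: y e => // a y e; have [] := H (size p) (size y).+1 => //.
  by rewrite e !size_cat /=; lia.
move=> t lt_t; case; rewrite e !nth_cat.
have -> : size p + t < size p = false by lia.
have -> : size p + (size y).+1 + t < size p = false by lia.
have -> : size p + t - size p = t by lia.
have -> : size p + (size y).+1 + t - size p = t + (size y).+1 by lia.
have -> : t < size (a :: y) by [].
have -> : t + (size y).+1 < size (a :: y) = false by (rewrite /=; lia).
have -> : t + (size y).+1 - size (a :: y) = t by (rewrite /=; lia).
by have -> : t < size (a :: y) by [].
Qed.

Lemma nth_squarefree (T : Type) (x0 : T) (s : seq T) i n :
  squarefree s -> 0 < n -> i + n + n <= size s ->
  ~ (forall t, t < n -> nth x0 s (i + t) = nth x0 s (i + n + t)).
Proof.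
move=> sq n_gt0 le_s H.
have e : take n (drop i s) = take n (drop (i + n) s).
  apply: (@eq_from_nth _ x0) => [|t].
    by rewrite !size_takel // size_drop; lia.
  rewrite size_takel => [lt_t|]; last by rewrite size_drop; lia.
  by rewrite !nth_take // !nth_drop H.
have : take n (drop i s) = [::].
  apply: (sq (take i s) _ (drop (i + n + n) s)).
  rewrite {2}e [drop (i + n + n) s](_ : _ = drop n (drop (i + n) s)); last first.
    by rewrite drop_drop addnC.
  rewrite cat_take_drop [drop (i + n) s](_ : _ = drop n (drop i s)).
    by rewrite !cat_take_drop.
  by rewrite drop_drop addnC.
by move/(congr1 size); rewrite size_takel ?size_drop /=; lia.
Qed.

(** * The alphabet *)

Definition colour : finType := (bool * bool)%type.
Definition symbol : finType := (colour + 'I_3 * 'I_18)%type.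

(** [Root] is the head at rest, and [Open] what it leaves behind; [Lft], [Rgt]
    and [Held] carry one symbol of text, according to whether the head is on
    the right of it, on the left of it, or has picked it up for comparison.
    [MarkJ] remembers likewise on which side of it the head is, so that a head
    finds its way from the cells next to it.  The other constructors are the
    heads; their boolean is the mode. *)
Inductive cell :=
| Root of colour | Open of colour
| Lft of symbol | Rgt of symbol | Held of symbol
| MarkI | MarkJ of bool
| Scan | Place of bool | Ready of bool | Carry of bool & symbol | Back of bool.

Definition cell_sum : finType :=
  (bool * colour + (unit + bool + bool) * symbol +
   (unit + bool + unit + (bool + bool + bool)))%type.

Definition cell_code (e : cell) : cell_sum :=
  match e with
  | Root x => inl (inl (false, x)) | Open x => inl (inl (true, x))
  | Held s => inl (inr (inl (inl tt), s))
  | Lft s => inl (inr (inl (inr true), s))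
  | Rgt s => inl (inr (inl (inr false), s))
  | Carry d s => inl (inr (inr d, s))
  | MarkI => inr (inl (inl (inl tt)))
  | MarkJ b => inr (inl (inl (inr b)))
  | Scan => inr (inl (inr tt))
  | Place d => inr (inr (inl (inl d)))
  | Ready d => inr (inr (inl (inr d)))
  | Back d => inr (inr (inr d))
  end.

Definition cell_decode (c : cell_sum) : cell :=
  match c with
  | inl (inl (false, x)) => Root x | inl (inl (true, x)) => Open x
  | inl (inr (inl (inl _), s)) => Held s
  | inl (inr (inl (inr true), s)) => Lft s
  | inl (inr (inl (inr false), s)) => Rgt s
  | inl (inr (inr d, s)) => Carry d s
  | inr (inl (inl (inl _))) => MarkI
  | inr (inl (inl (inr b))) => MarkJ b
  | inr (inl (inr _)) => Scan
  | inr (inr (inl (inl d))) => Place d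
  | inr (inr (inl (inr d))) => Ready d
  | inr (inr (inr d)) => Back d
  end.

Lemma cell_codeK : cancel cell_code cell_decode.
Proof. by case. Qed.

HB.instance Definition _ := Finite.copy cell (can_type cell_codeK).

(** [Front x] closes the zone of colour [x] on the right. *)
Inductive letter := Start | Base of colour | Front of colour | Cell of cell.

Definition letter_sum : finType := (unit + bool * colour + cell)%type.

Definition letter_code (a : letter) : letter_sum :=
  match a with
  | Start => inl (inl tt) | Base x => inl (inr (false, x))
  | Front x => inl (inr (true, x)) | Cell e => inr e
  end.

Definition letter_decode (c : letter_sum) : letter :=
  match c with
  | inl (inl _) => Start | inl (inr (false, x)) => Base x
  | inl (inr (true, x)) => Front x | inr e => Cell e
  end.

Lemma letter_codeK : cancel letter_code letter_decode.
Proof. by case. Qed.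

HB.instance Definition _ := Finite.copy letter (can_type letter_codeK).

(** There are 308 cells, and 18 * 18 = 324. *)
Lemma card_cell : #|{: cell}| <= #|{: 'I_18 * 'I_18}|.
Proof.
have le := leq_card cell_code (can_inj cell_codeK).
apply: leq_trans le _.
by rewrite !(card_sum, card_prod, card_bool, card_unit, card_ord).
Qed.

Definition digits (e : cell) : 'I_18 * 'I_18 :=
  enum_val (widen_ord card_cell (enum_rank e)).

Lemma digits_inj : injective digits.
Proof.
by move=> e f /enum_val_inj /(congr1 val) /= /val_inj /enum_rank_inj.
Qed.

(** * The code *)

(** The symbol of a [Carry] is not counted, since [Held] shows it already. *)
Definition hat (e : cell) : option colour :=
  match e with
  | Root x | Open x | Lft (inl x) | Rgt (inl x) | Held (inl x) => Some x
  | _ => None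
  end.

Definition hats : seq cell -> seq colour := pmap hat.

(** The offsets make the period of any repetition a multiple of 3.  The first
    digit stands at both ends, so that a window of such a length, wherever it
    starts, sees both digits of as many consecutive cells as it has blocks. *)
Definition block e : seq ('I_3 * 'I_18) :=
  [:: (@inord 2 0, (digits e).1); (@inord 2 1, (digits e).2);
      (@inord 2 2, (digits e).1)].

(** The hat is a separate symbol in front of the block, so that the colours and
    the digits of a text can be read independently. *)
Definition code (e : cell) : seq symbol :=
  if hat e is Some x then inl x :: map inr (block e) else map inr (block e).

Arguments code : simpl never.

Definition encode (v : seq cell) : seq symbol := flatten (map code v).

Definition symbol_hat (s : symbol) := if s is inl x then Some x else None.
Definition symbol_digit (s : symbol) := if s is inr z then Some z else None.

Lemma encode_cat v w : encode (v ++ w) = encode v ++ encode w.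
Proof. by rewrite /encode map_cat flatten_cat. Qed.

Lemma encode_rcons v e : encode (rcons v e) = encode v ++ code e.
Proof. by rewrite -cats1 encode_cat /encode /= cats0. Qed.

Lemma encode_hats v : pmap symbol_hat (encode v) = hats v.
Proof.
elim: v => //= e v IH; rewrite /encode /= pmap_cat -/(encode v) IH /code.
by case: (hat e).
Qed.

Lemma encode_digits v :
  pmap symbol_digit (encode v) = flatten (map block v).
Proof.
elim: v => //= e v IH; rewrite /encode /= pmap_cat -/(encode v) IH /code.
by case: (hat e).
Qed.

Definition digit o e := if o == 1 then (digits e).2 else (digits e).1.

Lemma nth_blocks z0 e0 v m o : m < size v -> o < 3 ->
  nth z0 (flatten (map block v)) (m * 3 + o) =
  (@inord 2 o, digit o (nth e0 v m)).
Proof.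
elim: v m => // e v IH [|m] /=; last first.
  by move=> lt_m lt_o; rewrite -(IH m) // mulSn.
by move=> _ {IH}; case: o => [|[|[|o]]].
Qed.

Lemma size_blocks v : size (flatten (map block v)) = size v * 3.
Proof. by elim: v => //= e v ->. Qed.

Lemma blocks_squarefree v :
  squarefree v -> squarefree (flatten (map block v)).
Proof.
case: v => [|e0 v0] sqv; first by move=> [|? ?] [|? ?].
set v := e0 :: v0 in sqv *; set z0 : 'I_3 * 'I_18 := (ord0, ord0).
apply: (@squarefree_nth _ z0) => i n n_gt0; rewrite size_blocks => le_v.
apply: contrapT => no.
have same t : t < n -> nth z0 (flatten (map block v)) (i + t) =
    nth z0 (flatten (map block v)) (i + n + t).
  by move=> lt_t; apply: contrapT => ne; apply: no; exists t.
have at_ j : j < size v * 3 -> nth z0 (flatten (map block v)) j =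
    (@inord 2 (j %% 3), digit (j %% 3) (nth e0 v (j %/ 3))).
  by move=> lt_j; rewrite {1}(divn_eq j 3) (nth_blocks z0 e0) //; lia.
have per : n %% 3 = 0.
  have := same 0 n_gt0; rewrite !at_ ?addn0; try lia.
  by move=> [] /(congr1 val); rewrite /= !inordK; lia.
have [q qE] : exists q, n = q * 3 by exists (n %/ 3); lia.
have dig t : t < n -> digit ((i + t) %% 3) (nth e0 v ((i + t) %/ 3)) =
    digit ((i + t) %% 3) (nth e0 v ((i + t) %/ 3 + q)).
  move=> lt_t; have := same t lt_t; rewrite !at_; try lia.
  have -> : (i + n + t) %% 3 = (i + t) %% 3 by lia.
  have -> : (i + n + t) %/ 3 = (i + t) %/ 3 + q by lia.
  by case.
(* Two consecutive positions of a block determine its cell; a window that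
   starts inside a block at offset 2 misses that block but reaches offset 1
   of the block after its last full one. *)
have eqc m : (i + 1) %/ 3 <= m -> m < (i + 1) %/ 3 + q ->
    nth e0 v m = nth e0 v (m + q).
  move=> le_m lt_m; apply: digits_inj.
  have use j : i <= j -> j < i + n -> j %/ 3 = m ->
      digit (j %% 3) (nth e0 v m) = digit (j %% 3) (nth e0 v (m + q)).
    move=> le_j lt_j jm; have := dig (j - i); rewrite subnKC // jm; apply; lia.
  have snd : (digits (nth e0 v m)).2 = (digits (nth e0 v (m + q))).2.
    have := use (m * 3 + 1); rewrite modnMDl /=; apply; lia.
  have fst : (digits (nth e0 v m)).1 = (digits (nth e0 v (m + q))).1.
    have [lo|hi] := leqP i (m * 3).
      by have := use (m * 3 + 0); rewrite modnMDl /=; apply; lia.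
    by have := use (m * 3 + 2); rewrite modnMDl /=; apply; lia.
  by rewrite [LHS]surjective_pairing fst snd -surjective_pairing.
apply: (@nth_squarefree _ e0 v ((i + 1) %/ 3) q sqv); try lia.
move=> t lt_t; rewrite eqc; try lia.
by congr (nth _ _ _); lia.
Qed.

(** A square of symbols has no hat, since the hats are squarefree, and no digit,
    since the digits are; so it is empty. *)
Lemma encode_squarefree v :
  squarefree v -> squarefree (hats v) -> squarefree (encode v).
Proof.
move=> sqv sqh p y q e.
have yh : pmap symbol_hat y = [::].
  by apply: (squarefree_pmap _ e); rewrite encode_hats.
have yd : pmap symbol_digit y = [::].
  by apply: (squarefree_pmap _ e); rewrite encode_digits; exact: blocks_squarefree.
by case: y yh yd {e} => // [[]].
Qed.

(** The last three symbols of a text determine the last cell that was coded, so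
    a front can be moved back to the left. *)
Lemma code_suffix v T e : encode v = T ++ code e ->
  exists2 v', v = rcons v' e & encode v' = T.
Proof.
case/lastP: v => [|v f] E.
  by move: (congr1 size E); rewrite size_cat /code; case: (hat e) => /=; lia.
have fe : f = e.
  have [p pE] : exists p, code f = p ++ map inr (block f).
    by rewrite /code; case: (hat f) => [x|]; [exists [:: inl x] | exists [::]].
  have [q qE] : exists q, code e = q ++ map inr (block e).
    by rewrite /code; case: (hat e) => [x|]; [exists [:: inl x] | exists [::]].
  apply: digits_inj; move: E; rewrite encode_rcons pE qE !catA.
  move/(congr1 rev); rewrite !rev_cat /= /rev /=.
  case: (digits f) (digits e) => a b [a' b'] /=.
  by case=> -> -> *.
subst f; exists v => //.
by move: E; rewrite encode_rcons => /cat_injr.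
Qed.

(** * Zones and moves of the head *)

(** The symbols that are compared in the mode [d]: all of them, or the hats. *)
Definition tracked (d : bool) (s : symbol) : bool :=
  d || (if s is inl _ then true else false).

Definition track d : seq symbol -> seq symbol := filter (tracked d).

Definition ends (T : Type) (s t : seq T) := exists u, t = u ++ s.

(** A symbol of text, or the mark J if [None], as it looks on the left and on
    the right of the head. *)
Definition lcell (o : option symbol) : cell :=
  if o is Some s then Lft s else MarkJ true.

Definition rcell (o : option symbol) : cell :=
  if o is Some s then Rgt s else MarkJ false.

Definition split_text (B C : seq symbol) := map Some B ++ None :: map Some C.

Definition opened x A (u : seq (option symbol)) : seq cell :=
  (Open x :: map Lft A) ++ MarkI :: map lcell u.

(** The states [l ++ h :: r] of the machine of a zone of colour [x] whose front
    has coded the content [v].  The mark I stands between [A] and [B], the mark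
    J between [B] and [C], and [C] has been compared already: its tracked
    symbols were matched, in order, with the last ones that the mark I passed,
    which is the condition on [ends].  With [B] empty, [track d A] ends in
    [track d C]: that is a square. *)
Definition zone x v (l : seq cell) (h : cell) (r : seq cell) : Prop :=
  match h with
  | Root y => [/\ y = x, l = [::] & r = map Rgt (encode v)]
  | Scan => exists A B,
      [/\ encode v = A ++ B, l = Open x :: map Lft A & r = map Rgt B]
  | Place d => exists A B C,
      [/\ encode v = A ++ B ++ C, l = opened x A (map Some B)
        & r = map Rgt C]
  | Ready d => exists A B C D,
      [/\ encode v = A ++ B ++ C ++ D, ends (track d C) (track d A),
          l = opened x A (split_text B C) & r = map Rgt D]
  | Carry d s => exists A B C D u1 u2,
      [/\ encode v = A ++ B ++ C ++ s :: D,
          tracked d s /\ ends (track d C) (track d A),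
          u1 ++ u2 = split_text B C,
          l = opened x A u1 & r = map rcell u2 ++ Held s :: map Rgt D]
  | Back d => exists A B C s D u1 u2,
      [/\ encode v = A ++ B ++ C ++ s :: D,
          tracked d s /\ ends (track d (rcons C s)) (track d A),
          u1 ++ u2 = split_text B C,
          l = opened x A u1 & r = map rcell u2 ++ Held s :: map Rgt D]
  | _ => False
  end.

(** [move p h q p' h' q'] replaces the cells [p ++ h :: q] by [p' ++ h' :: q'].
    A head drops the mark I ([move_mark]) and the mark J ([move_start]) at any
    time, picks up the next tracked symbol after J ([move_pick]), carries it to
    the left up to I ([move_carry]), moves I over an equal symbol
    ([move_match]) and over untracked ones ([move_hop]), and goes back
    ([move_back]) to release the symbol ([move_done]). *)
Inductive move : seq cell -> cell -> seq cell ->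
                 seq cell -> cell -> seq cell -> Prop :=
| move_open x : move [::] (Root x) [::] [:: Open x] Scan [::]
| move_scan s : move [::] Scan [:: Rgt s] [:: Lft s] Scan [::]
| move_mark d : move [::] Scan [::] [:: MarkI] (Place d) [::]
| move_place d s : move [::] (Place d) [:: Rgt s] [:: Lft s] (Place d) [::]
| move_start d : move [::] (Place d) [::] [:: MarkJ true] (Ready d) [::]
| move_skip d s : ~~ tracked d s ->
    move [::] (Ready d) [:: Rgt s] [:: Lft s] (Ready d) [::]
| move_pick d s : tracked d s ->
    move [::] (Ready d) [:: Rgt s] [::] (Carry d s) [:: Held s]
| move_carry d s o :
    move [:: lcell o] (Carry d s) [::] [::] (Carry d s) [:: rcell o]
| move_match d s : tracked d s ->
    move [:: MarkI] (Carry d s) [:: Rgt s] [:: Lft s; MarkI] (Back d) [::]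
| move_hop d s : ~~ tracked d s ->
    move [:: MarkI] (Back d) [:: Rgt s] [:: Lft s; MarkI] (Back d) [::]
| move_back d o :
    move [::] (Back d) [:: rcell o] [:: lcell o] (Back d) [::]
| move_done d s : tracked d s ->
    move [::] (Back d) [:: Held s] [:: Lft s] (Ready d) [::].

Lemma rcell_inj : injective rcell.
Proof. by move=> [s|] [t|] //= [->]. Qed.

Lemma lcell_inj : injective lcell.
Proof. by move=> [s|] [t|] //= [->]. Qed.

Lemma rcell_Rgt o s : rcell o = Rgt s -> o = Some s.
Proof. by case: o => //= t [->]. Qed.

Lemma Rgt_inj : injective Rgt. Proof. by move=> s t []. Qed.

Variant last_opened x A u l c : Prop :=
| LastMark of u = [::] & c = MarkI & l = Open x :: map Lft A
| LastText u' o of u = rcons u' o & c = lcell o & l = opened x A u'.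

Lemma last_openedP x A u l c : l ++ [:: c] = opened x A u ->
  last_opened x A u l c.
Proof.
rewrite /opened cats1; case/lastP: u => [|u o] /=.
  rewrite cats1 -rcons_cons => /rcons_inj [-> ->]; exact: LastMark.
rewrite map_rcons -rcons_cons -rcons_cat -rcons_cons => /rcons_inj [-> ->].
exact: LastText.
Qed.

Variant last_scanned x A l c : Prop :=
| LastOpen of A = [::] & c = Open x & l = [::]
| LastLft A' s of A = rcons A' s & c = Lft s & l = Open x :: map Lft A'.

Lemma last_scannedP x A l c : l ++ [:: c] = Open x :: map Lft A ->
  last_scanned x A l c.
Proof.
rewrite cats1; case/lastP: A => [|A s] /=.
  by rewrite -[[:: Open x]]/(rcons [::] _) => /rcons_inj [-> ->]; exact: LastOpen.
by rewrite map_rcons -rcons_cons => /rcons_inj [-> ->]; exact: LastLft.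
Qed.

Lemma opened_rcons x A u o : opened x A (rcons u o) = opened x A u ++ [:: lcell o].
Proof. by rewrite /opened map_rcons cats1 -rcons_cons -rcons_cat. Qed.

Lemma opened_shift x A s : opened x (rcons A s) [::] = 
  (Open x :: map Lft A) ++ [:: Lft s; MarkI].
Proof. by rewrite /opened map_rcons /= cat_rcons. Qed.

Lemma track_rcons d s t : track d (rcons s t) =
  if tracked d t then rcons (track d s) t else track d s.
Proof. exact: filter_rcons. Qed.

Lemma ends_rcons (T : Type) (s t : seq T) a b :
  ends (rcons s a) (rcons t b) <-> a = b /\ ends s t.
Proof.
split=> [[u]|[-> [u ->]]]; last by exists u; rewrite rcons_cat.
by rewrite -rcons_cat => /rcons_inj [-> ->]; split=> //; exists u.
Qed.

Lemma ends_nil (T : Type) (t : seq T) : ends [::] t.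
Proof. by exists t; rewrite cats0. Qed.

Lemma split_text_rcons B C s :
  split_text B (rcons C s) = rcons (split_text B C) (Some s).
Proof. by rewrite /split_text map_rcons -rcons_cons -rcons_cat. Qed.

Lemma last_split_text B C u o : split_text B C = rcons u o ->
  (C = [::] /\ o = None /\ u = map Some B) \/
  exists C' s, [/\ C = rcons C' s, o = Some s & u = split_text B C'].
Proof.
case/lastP: C => [|C s]; first by rewrite /split_text /= cats1 => /rcons_inj [<- <-]; left.
by rewrite split_text_rcons => /rcons_inj [<- <-]; right; exists C, s.
Qed.

(** The text stays the same; only its division by the marks and the place of
    the head change.  A move can be undone because the cells next to the head
    tell how it came there. *)
Lemma zone_move x v p h q p' h' q' l r : move p h q p' h' q' ->
  zone x v (l ++ p) h (q ++ r) <-> zone x v (l ++ p') h' (q' ++ r).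
Proof.
case=> {p h q p' h' q'} /=.
- move=> y; rewrite cats0; split=> [[-> -> ->]|[A [B [e]]]].
    by exists [::], (encode v).
  by case/last_scannedP=> // eA [->] -> ->; split=> //; rewrite e eA.
- move=> s; rewrite cats0; split=> [[A [B [e -> eB]]]|[A [B [e]]]].
    case: B eB e => // _ B [<- ->] e; exists (rcons A s), B.
    by rewrite e cat_rcons map_rcons cats1.
  case/last_scannedP=> // A' s1 eA [es] -> ->; rewrite -{}es in eA; exists A', (s :: B).
  by rewrite e eA cat_rcons.
- move=> d; rewrite cats0; split=> [[A [B [e -> ->]]]|[A [B [C [e]]]]].
    by exists A, [::], B.
  case/last_openedP=> [eB _ -> ->|? [?|] ? //]; exists A, C.
  by rewrite e; case: B eB {e}.
- move=> d s; rewrite cats0; split=> [[A [B [C [e -> eC]]]]|[A [B [C [e]]]]].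
    case: C eC e => // _ C [<- ->] e; exists A, (rcons B s), C.
    by rewrite e cat_rcons map_rcons opened_rcons.
  case/last_openedP=> // u [t|] // eB [es] -> ->; rewrite -{}es {t} in eB.
  case/lastP: B eB e => [/(congr1 size)|B t']; first by rewrite size_rcons.
  rewrite map_rcons => /rcons_inj [<- ->] e; exists A, B, (s :: C).
  by rewrite e cat_rcons.
- move=> d; rewrite cats0; split=> [[A [B [C [e -> ->]]]]|[A [B [C [D [e _]]]]]].
    exists A, B, [::], C; split=> //; first exact: ends_nil.
    by rewrite /split_text /= [map Some B ++ _]cats1 opened_rcons.
  case/last_openedP=> // u [t|] // eB _ -> ->.
  case: (last_split_text eB) => [[eC [_ ->]]|[? [? []]] //].
  by exists A, B, D; rewrite e eC.
- move=> d s ns; rewrite cats0.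
  split=> [[A [B [C [D [e eA -> eD]]]]]|[A [B [C [D [e eA]]]]]].
    case: D eD e => // _ D [<- ->] e; exists A, B, (rcons C s), D.
    by rewrite e cat_rcons track_rcons (negbTE ns) split_text_rcons opened_rcons.
  case/last_openedP=> // u [t|] // eB [es] -> ->; rewrite -{}es {t} in eB.
  case: (last_split_text eB) => [[? []] //|[C' [s1 [eC [es] ->]]]].
  exists A, B, C', (s :: D); rewrite -{}es in eC; rewrite e eC cat_rcons; split=> //.
  by move: eA; rewrite eC track_rcons (negbTE ns).
- move=> d s ts; rewrite !cats0.
  split=> [[A [B [C [D [e eA -> eD]]]]]|[A [B [C [D [u1 [u2 [e [_ eA] eu ->]]]]]]]].
    case: D eD e => // _ D [<- ->] e.
    by exists A, B, C, D, (split_text B C), [::]; rewrite cats0.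
  case: u2 eu => [|[t|] u2] //; rewrite cats0 => -> [->].
  by exists A, B, C, (s :: D).
- move=> d s o; rewrite cats0.
  split=> [[A [B [C [D [u1 [u2 [e eA eu]]]]]]]|[A [B [C [D [u1 [u2 [e eA eu -> er]]]]]]]].
    case/last_openedP=> [_|u o' eu1 /lcell_inj eo -> ->]; first by case: o.
  rewrite -{}eo in eu1.
    exists A, B, C, D, u, (o :: u2); split=> //.
    by rewrite -eu eu1 cat_rcons.
  case: u2 eu er => [|o' u2] eu []; first by case: o.
  move=> /rcell_inj eo ->; rewrite -{}eo in eu; exists A, B, C, D, (rcons u1 o), u2; split=> //.
    by rewrite cat_rcons.
  by rewrite opened_rcons.
- move=> d s ts; split=> [[A [B [C [D [u1 [u2 [e [_ eA] eu]]]]]]]|].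
    case/last_openedP=> [eu1 _ -> |? [?|] ? //].
    rewrite {}eu1 in eu; case: u2 eu => // o u2 eu [] /esym/rcell_Rgt eo ->.
    rewrite {}eo in eu.
    case: B e eu => // s1 B e [es] eu; rewrite -{}es in e; exists (rcons A s), B, C, s, D, [::], u2.
    split=> //; first by rewrite e cat_rcons.
      by split=> //; rewrite !track_rcons ts; apply/ends_rcons.
    by rewrite opened_shift.
  move=> [A [B [C [s' [D [u1 [u2 [e [ts' eA] eu]]]]]]]].
  rewrite -[[:: Lft s; MarkI]]/([:: Lft s] ++ [:: MarkI]) catA.
  case/last_openedP=> [eu1 _ |? [?|] ? //].
  case/last_scannedP=> // A' s1 eA' [es] -> ->; rewrite -{}es in eA'.
  move: eA; rewrite eA' !track_rcons ts ts' => /ends_rcons [es eA].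
  rewrite {}es in e *; rewrite {}eu1 in eu.
  exists A', (s :: B), C, D, [::], (Some s :: u2); split=> //.
    by rewrite e eA' cat_rcons.
  by move: eu => /= ->.
- move=> d s ns; split=> [[A [B [C [s' [D [u1 [u2 [e eA eu]]]]]]]]|].
    case/last_openedP=> [eu1 _ -> |? [?|] ? //].
    rewrite {}eu1 in eu; case: u2 eu => // o u2 eu [] /esym/rcell_Rgt eo ->.
    rewrite {}eo in eu.
    case: B e eu => // s1 B e [es] eu; rewrite -{}es in e; exists (rcons A s), B, C, s', D, [::], u2.
    split=> //; first by rewrite e cat_rcons.
      by rewrite [track _ (rcons A s)]track_rcons (negbTE ns).
    by rewrite opened_shift.
  move=> [A [B [C [s' [D [u1 [u2 [e eA eu]]]]]]]].
  rewrite -[[:: Lft s; MarkI]]/([:: Lft s] ++ [:: MarkI]) catA.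
  case/last_openedP=> [eu1 _ |? [?|] ? //].
  case/last_scannedP=> // A' s1 eA' [es] -> ->; rewrite -{}es in eA'.
  move: eA; rewrite eA' [track _ (rcons A' s)]track_rcons (negbTE ns) => eA.
  rewrite {}eu1 in eu.
  exists A', (s :: B), C, s', D, [::], (Some s :: u2); split=> //.
    by rewrite e eA' cat_rcons.
  by move: eu => /= ->.
- move=> d o; rewrite cats0.
  split=> [[A [B [C [s [D [u1 [u2 [e eA eu -> er]]]]]]]]|[A [B [C [s [D [u1 [u2 [e eA eu]]]]]]]]].
    case: u2 eu er => [|o' u2] eu []; first by case: o.
    move=> /rcell_inj eo ->; rewrite -{}eo in eu; exists A, B, C, s, D, (rcons u1 o), u2; split=> //.
      by rewrite cat_rcons.
    by rewrite opened_rcons.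
  case/last_openedP=> [_|u o' eu1 /lcell_inj eo -> ->]; first by case: o.
  rewrite -{}eo in eu1.
  exists A, B, C, s, D, u, (o :: u2); split=> //.
  by rewrite -eu eu1 cat_rcons.
- move=> d s ts; rewrite cats0.
  split=> [[A [B [C [s' [D [u1 [u2 [e [_ eA] eu -> er]]]]]]]]|[A [B [C [D [e eA]]]]]].
    case: u2 eu er => [|[t|] u2] //; rewrite cats0 => -> [es ->].
    rewrite -{}es in e eA; exists A, B, (rcons C s), D; split=> //; first by rewrite e cat_rcons.
    by rewrite split_text_rcons opened_rcons.
  case/last_openedP=> // u [t|] // eB [es] -> ->; rewrite -{}es {t} in eB.
  case: (last_split_text eB) => [[? []] //|[C' [s1 [eC [es] ->]]]].
  exists A, B, C', s, D, (split_text B C'), [::]; rewrite -{}es in eC; rewrite e eC cat_rcons cats0.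
  by split=> //; rewrite -eC.
Qed.

(** * Shape of a zone *)

Definition is_head (e : cell) : bool :=
  match e with
  | Root _ | Scan | Place _ | Ready _ | Carry _ _ | Back _ => true
  | _ => false
  end.

Definition text (e : cell) : option symbol :=
  match e with Lft s | Rgt s | Held s => Some s | _ => None end.

Lemma opened_headless x A u : has is_head (opened x A u) = false.
Proof.
rewrite /opened has_cat /= !has_map.
by rewrite !(@eq_has _ _ pred0) ?has_pred0 // => [[]].
Qed.

Lemma Rgt_headless A : has is_head (map Rgt A) = false.
Proof. by rewrite has_map (@eq_has _ _ pred0) ?has_pred0. Qed.

Lemma rcell_headless u : has is_head (map rcell u) = false.
Proof. by rewrite has_map (@eq_has _ _ pred0) ?has_pred0 // => [[]]. Qed.

Lemma zone_heads x v l h r : zone x v l h r ->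
  [/\ is_head h, has is_head l = false & has is_head r = false].
Proof.
case: h => //=.
- by move=> y [_ -> ->]; rewrite Rgt_headless.
- move=> [A [B [_ -> ->]]]; rewrite Rgt_headless; split=> //=.
  by rewrite has_map (@eq_has _ _ pred0) ?has_pred0.
- by move=> d [A [B [C [_ -> ->]]]]; rewrite opened_headless Rgt_headless.
- by move=> d [A [B [C [D [_ _ -> ->]]]]]; rewrite opened_headless Rgt_headless.
- move=> d s [A [B [C [D [u1 [u2 [_ _ _ -> ->]]]]]]].
  by rewrite opened_headless has_cat rcell_headless /= Rgt_headless.
- move=> d [A [B [C [s [D [u1 [u2 [_ _ _ -> ->]]]]]]]].
  by rewrite opened_headless has_cat rcell_headless /= Rgt_headless.
Qed.

Lemma head_split a h b l k r :
  is_head h -> is_head k -> has is_head l = false -> has is_head r = false ->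
  a ++ h :: b = l ++ k :: r -> [/\ a = l, h = k & b = r].
Proof.
move=> hh hk + hr; elim: a l => [|c a IH] [|c' l] //=.
- by move=> _ [-> ->].
- by move=> /norP [nc _] [hc]; rewrite -hc hh in nc.
- move=> _ [_ br]; move: hr; rewrite -br has_cat /= hh orbT.
  by [].
- by move=> /norP [_ /negbTE nl] [-> /(IH _ nl) [-> -> ->]].
Qed.

Lemma move_heads p h q p' h' q' : move p h q p' h' q' ->
  [/\ is_head h, is_head h',
      has is_head p = false /\ has is_head q = false &
      has is_head p' = false /\ has is_head q' = false].
Proof. by case=> //= d => [s|] [] // s; split=> //; case: s. Qed.

Lemma pmap_Lft A : pmap text (map Lft A) = A.
Proof. by elim: A => //= s A ->. Qed.

Lemma pmap_Rgt A : pmap text (map Rgt A) = A.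
Proof. by elim: A => //= s A ->. Qed.

Lemma pmap_lcell u : pmap text (map lcell u) = pmap id u.
Proof. by elim: u => //= [[s|] u] /= ->. Qed.

Lemma pmap_rcell u : pmap text (map rcell u) = pmap id u.
Proof. by elim: u => //= [[s|] u] /= ->. Qed.

Lemma pmap_Some (T : Type) (A : seq T) : pmap id (map Some A) = A.
Proof. by elim: A => //= s A ->. Qed.

Lemma pmap_split_text B C : pmap id (split_text B C) = B ++ C.
Proof. by rewrite /split_text pmap_cat /= !pmap_Some. Qed.

Lemma pmap_opened x A u : pmap text (opened x A u) = A ++ pmap id u.
Proof. by rewrite /opened pmap_cat /= pmap_Lft pmap_lcell. Qed.

Lemma zone_text x v l h r : zone x v l h r ->
  pmap text (l ++ h :: r) = encode v.
Proof.
rewrite pmap_cat; case: h => //=.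
- by move=> y [_ -> ->]; rewrite pmap_Rgt.
- by move=> [A [B [-> -> ->]]]; rewrite /= pmap_Lft pmap_Rgt.
- move=> d [A [B [C [-> -> ->]]]].
  by rewrite pmap_opened pmap_Some pmap_Rgt -catA.
- move=> d [A [B [C [D [-> _ -> ->]]]]].
  by rewrite pmap_opened pmap_split_text pmap_Rgt -!catA.
- move=> d s [A [B [C [D [u1 [u2 [-> _ eu -> ->]]]]]]].
  rewrite pmap_opened pmap_cat /= pmap_rcell pmap_Rgt -!catA (catA (pmap _ u1)).
  by rewrite -pmap_cat eu pmap_split_text -catA.
- move=> d [A [B [C [s [D [u1 [u2 [-> _ eu -> ->]]]]]]]].
  rewrite pmap_opened pmap_cat /= pmap_rcell pmap_Rgt -!catA (catA (pmap _ u1)).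
  by rewrite -pmap_cat eu pmap_split_text -catA.
Qed.

Definition is_root e := match e with Root _ | Open _ => true | _ => false end.

Lemma hats_text s : ~~ has is_root s -> hats s = pmap symbol_hat (pmap text s).
Proof.
elim: s => //= e s IH /norP [ne /IH]; rewrite /hats /= => ->.
by case: e ne => //= [[]|[]|[]].
Qed.

(** A zone shows its colour in its first cell only, and all its other hats come
    from its text. *)
Lemma zone_root x v l h r : zone x v l h r ->
  exists e w, [/\ l ++ h :: r = e :: w, hat e = Some x, text e = None,
    ~~ has is_root w & (if e is Root _ then True else h <> e)].
Proof.
have roots A : has is_root (map Lft A) = false.
  by rewrite has_map (@eq_has _ _ pred0) ?has_pred0.
have rootsR A : has is_root (map Rgt A) = false.
  by rewrite has_map (@eq_has _ _ pred0) ?has_pred0.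
have rootsl u : has is_root (map lcell u) = false.
  by rewrite has_map (@eq_has _ _ pred0) ?has_pred0 // => [[]].
have rootsr u : has is_root (map rcell u) = false.
  by rewrite has_map (@eq_has _ _ pred0) ?has_pred0 // => [[]].
case: h => //=.
- by move=> y [-> -> ->]; do 2!eexists; split=> //=; rewrite rootsR.
- move=> [A [B [_ -> ->]]]; do 2!eexists; split=> //=.
  by rewrite has_cat /= roots rootsR.
- move=> d [A [B [C [_ -> ->]]]]; do 2!eexists; split=> //=.
  by rewrite !has_cat /= roots rootsR rootsl.
- move=> d [A [B [C [D [_ _ -> ->]]]]]; do 2!eexists; split=> //=.
  by rewrite !has_cat /= roots rootsR rootsl.
- move=> d s [A [B [C [D [u1 [u2 [_ _ _ -> ->]]]]]]]; do 2!eexists; split=> //=.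
  by rewrite !has_cat /= has_cat /= roots rootsR rootsl rootsr.
- move=> d [A [B [C [s [D [u1 [u2 [_ _ _ -> ->]]]]]]]]; do 2!eexists; split=> //=.
  by rewrite !has_cat /= has_cat /= roots rootsR rootsl rootsr.
Qed.

Lemma zone_hats x v l h r : zone x v l h r -> hats (l ++ h :: r) = x :: hats v.
Proof.
move=> z; rewrite -(encode_hats v) -(zone_text z).
have [e [w [-> he te nr _]]] := zone_root z.
by rewrite /hats /= he te /= -hats_text.
Qed.

Definition marks : seq cell -> seq cell := filter (fun e => text e == None).

Lemma marks_cat s t : marks (s ++ t) = marks s ++ marks t.
Proof. exact: filter_cat. Qed.

Lemma marks_Lft A : marks (map Lft A) = [::].
Proof. by elim: A. Qed.

Lemma marks_Rgt A : marks (map Rgt A) = [::].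
Proof. by elim: A. Qed.

Lemma marks_opened x A u :
  marks (opened x A u) = [:: Open x, MarkI & marks (map lcell u)].
Proof. by rewrite /opened marks_cat /= marks_Lft. Qed.

Lemma marks_lsome A : marks (map lcell (map Some A)) = [::].
Proof. by elim: A. Qed.

Lemma count_split_text B C u1 u2 : u1 ++ u2 = split_text B C ->
  count_mem None u1 + count_mem None u2 = 1.
Proof.
move=> e; rewrite -count_cat e /split_text count_cat /= !count_map.
by rewrite !(@eq_count _ _ pred0) ?count_pred0 // => ?; rewrite /= eqE.
Qed.

Lemma marks_lcell u : marks (map lcell u) = nseq (count_mem None u) (MarkJ true).
Proof. by elim: u => //= [[s|] u] /= ->. Qed.

Lemma marks_rcell u : marks (map rcell u) = nseq (count_mem None u) (MarkJ false).
Proof. by elim: u => //= [[s|] u] /= ->. Qed.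

(** The cells that carry no text occur once in a zone; hence a square in a zone
    would be a square of text. *)
Lemma zone_marks x v l h r : zone x v l h r -> uniq (marks (l ++ h :: r)).
Proof.
rewrite marks_cat; case: h => //=.
- by move=> y [_ -> ->]; rewrite marks_Rgt.
- by move=> [A [B [_ -> ->]]]; rewrite /= marks_Lft marks_Rgt.
- by move=> d [A [B [C [_ -> ->]]]]; rewrite marks_opened marks_lsome marks_Rgt.
- move=> d [A [B [C [D [_ _ -> ->]]]]].
  by rewrite marks_opened /split_text map_cat marks_cat /= !marks_lsome marks_Rgt.
- move=> d s [A [B [C [D [u1 [u2 [_ _ /count_split_text + -> ->]]]]]]].
  rewrite marks_opened marks_cat /= marks_lcell marks_rcell marks_Rgt.
  by case: (count_mem _ u1) (count_mem _ u2) => [|[|?]] [|[|?]].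
- move=> d [A [B [C [s [D [u1 [u2 [_ _ /count_split_text + -> ->]]]]]]]].
  rewrite marks_opened marks_cat /= marks_lcell marks_rcell marks_Rgt.
  by case: (count_mem _ u1) (count_mem _ u2) => [|[|?]] [|[|?]].
Qed.

(** A front that codes a cell lengthens the text of its zone on the right of the
    head, and a state does not constrain the end of that part. *)
Lemma zone_eat x v l h r e :
  zone x v l h r -> zone x (rcons v e) l h (r ++ map Rgt (code e)).
Proof.
case: h => //=.
- by move=> y [-> -> ->]; rewrite encode_rcons (map_cat _ (encode v)).
- move=> [A [B [E -> ->]]]; exists A, (B ++ code e).
  by rewrite encode_rcons E (map_cat _ B) catA.
- move=> d [A [B [C [E -> ->]]]]; exists A, B, (C ++ code e).
  by rewrite encode_rcons E (map_cat _ C) !catA.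
- move=> d [A [B [C [D [E eA -> ->]]]]]; exists A, B, C, (D ++ code e).
  by rewrite encode_rcons E (map_cat _ D) -!catA.
- move=> d s [A [B [C [D [u1 [u2 [E eA eu -> ->]]]]]]].
  exists A, B, C, (D ++ code e), u1, u2.
  by rewrite encode_rcons E (map_cat _ D) -!catA.
- move=> d [A [B [C [s [D [u1 [u2 [E eA eu -> ->]]]]]]]].
  exists A, B, C, s, (D ++ code e), u1, u2.
  by rewrite encode_rcons E (map_cat _ D) -!catA.
Qed.

Lemma cat_Rgt r c B : r ++ map Rgt c = map Rgt B ->
  exists2 B', B = B' ++ c & r = map Rgt B'.
Proof.
elim/last_ind: c B => [|c s IH] B; first by rewrite cats0 => ->; exists B; rewrite ?cats0.
rewrite map_rcons -rcons_cat; case/lastP: B => [|B t]; first by case: (_ ++ _).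
rewrite map_rcons => /rcons_inj [/IH [B' -> ->] ->]; exists B' => //.
by rewrite rcons_cat.
Qed.

Lemma cat_Rgt_held r c w s D : r ++ map Rgt c = w ++ Held s :: map Rgt D ->
  exists2 D', D = D' ++ c & r = w ++ Held s :: map Rgt D'.
Proof.
elim/last_ind: c D => [|c t IH] D.
  by rewrite cats0 => ->; exists D; rewrite ?cats0.
rewrite map_rcons -rcons_cat; case/lastP: D => [|D t'].
  by rewrite -cat_rcons cats0 => /rcons_inj [].
rewrite map_rcons -rcons_cons -rcons_cat => /rcons_inj [/IH [D' -> ->] ->].
by exists D' => //; rewrite rcons_cat.
Qed.

(** The code of the last cell can be given back even while the head is at work,
    as long as the head has not reached it. *)
Lemma zone_uneat x v l h r e : zone x v l h (r ++ map Rgt (code e)) ->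
  exists2 v', v = rcons v' e & zone x v' l h r.
Proof.
case: h => //=.
- move=> y [-> -> /cat_Rgt [B /code_suffix [v' -> <-] ->]]; by exists v'.
- move=> [A [B [E -> /cat_Rgt [B' eB ->]]]].
  move: E; rewrite eB catA => /code_suffix [v' -> E]; exists v' => //.
  by exists A, B'.
- move=> d [A [B [C [E -> /cat_Rgt [C' eC ->]]]]].
  move: E; rewrite eC !catA => /code_suffix [v' -> E]; exists v' => //.
  by exists A, B, C'; rewrite E -catA.
- move=> d [A [B [C [D [E eA -> /cat_Rgt [D' eD ->]]]]]].
  move: E; rewrite eD !catA => /code_suffix [v' -> E]; exists v' => //.
  by exists A, B, C, D'; rewrite E -!catA.
- move=> d s [A [B [C [D [u1 [u2 [E eA eu -> /cat_Rgt_held [D' eD ->]]]]]]]].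
  move: E; rewrite eD -cat_cons !catA => /code_suffix [v' -> E]; exists v' => //.
  by exists A, B, C, D', u1, u2; rewrite E -!catA.
- move=> d [A [B [C [s [D [u1 [u2 [E eA eu -> /cat_Rgt_held [D' eD ->]]]]]]]]].
  move: E; rewrite eD -cat_cons !catA => /code_suffix [v' -> E]; exists v' => //.
  by exists A, B, C, s, D', u1, u2; rewrite E -!catA.
Qed.

(** * Legitimate words *)

(** In [legit_zone] the zone of [x] has eaten the content [v]: before that, [v]
    stood in front of the word [w] that remains.  So a legitimate word carries
    its whole history, down to the word of [Start] and [Base] it came from, and
    eating a cell only moves it from the remaining word to the content. *)
Inductive legit : seq colour -> seq letter -> Prop :=
| legit_nil : legit [::] [::]
| legit_base x xs w : legit xs w -> legit (x :: xs) (Start :: Base x :: w)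
| legit_zone x xs v w l h r :
    legit xs (map Cell v ++ w) -> zone x v l h r ->
    legit (x :: xs) (map Cell (l ++ h :: r) ++ Front x :: w).

Lemma Cell_inj : injective Cell. Proof. by move=> e f []. Qed.

Lemma eq_cat_long (T : Type) (p s t w : seq T) :
  p ++ s = t ++ w -> size t <= size p -> exists2 p', p = t ++ p' & p' ++ s = w.
Proof.
elim: t p => [|a t IH] [|b p] //=; first by move=> ->; exists [::].
  by move=> <-; exists (b :: p).
by move=> [-> /IH e] /e [p' -> e']; exists p'.
Qed.

(** Induction on where [u] occurs: it starts inside the first block of the word,
    or else it occurs in what follows.  What follows a zone is legitimate only
    after the content of the zone has been restored in front of it, whence the
    prefix [map Cell v] in the last case. *)
Lemma legit_occurrence (u : seq letter)
    (P : seq colour -> seq letter -> seq letter -> Prop) :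
  u <> [::] ->
  (forall x xs w p q, legit xs w -> p ++ u ++ q = Start :: Base x :: w ->
     size p < 2 -> P (x :: xs) p q) ->
  (forall x xs v w l h r p q, legit xs (map Cell v ++ w) -> zone x v l h r ->
     p ++ u ++ q = map Cell (l ++ h :: r) ++ Front x :: w ->
     size p <= size (l ++ h :: r) -> P (x :: xs) p q) ->
  (forall x xs p q, P xs p q -> P (x :: xs) (Start :: Base x :: p) q) ->
  (forall x xs v l h r p q, zone x v l h r -> P xs (map Cell v ++ p) q ->
     P (x :: xs) (map Cell (l ++ h :: r) ++ Front x :: p) q) ->
  forall xs p q, legit xs (p ++ u ++ q) -> P xs p q.
Proof.
move=> u0 Hb Hz Db Dz xs p q; move wE: (p ++ u ++ q) => w lw.
elim: lw p q wE => {xs w} [|x xs w lw IH|x xs v w l h r lw IH z] p q e.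
- by case: p e => //; case: u u0 {Hb Hz}.
- have [lt|ge] := ltnP (size p) 2; first exact: Hb lw e lt.
  by have [p' -> /IH] := @eq_cat_long _ _ _ [:: Start; Base x] _ e ge; exact: Db.
- have [le|gt] := leqP (size p) (size (l ++ h :: r)); first exact: Hz lw z e le.
  have [||p' -> e'] := @eq_cat_long _ p (u ++ q) (rcons (map Cell (l ++ h :: r)) (Front x)) w.
  + by rewrite cat_rcons.
  + by rewrite size_rcons size_map.
  rewrite cat_rcons; apply: Dz z _; apply: IH.
  by rewrite -catA e'.
Qed.

Definition front (a : letter) : option colour :=
  match a with Base x | Front x => Some x | _ => None end.

Lemma fronts_Cell v : pmap front (map Cell v) = [::].
Proof. by elim: v. Qed.

Lemma legit_fronts xs w : legit xs w -> pmap front w = xs.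
Proof.
elim=> //= [x {}xs {}w _ -> //|x {}xs v {}w l h r _ + _].
by rewrite !pmap_cat !fronts_Cell /= => ->.
Qed.

Lemma cells_occurrence (u p q w : seq letter) W x :
  pmap front u = [::] -> p ++ u ++ q = map Cell W ++ Front x :: w ->
  size p <= size W ->
  exists a e b, [/\ p = map Cell a, u = map Cell e, W = a ++ e ++ b &
    q = map Cell b ++ Front x :: w].
Proof.
move=> fu; elim: W p => [|c W IH] [|a p] //=.
- case: u fu => [|b u] //= fu e; first by exists [::], [::], [::].
  by move=> _; case: e fu => ->.
- move=> e _; suff [f [b [-> -> ->]]] : exists f b,
      [/\ u = map Cell f, c :: W = f ++ b & q = map Cell b ++ Front x :: w].
    by exists [::], f, b.
  have {}e : u ++ q = map Cell (c :: W) ++ Front x :: w by [].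
  elim: u (c :: W) {IH} fu e => [|a u IHu] V fu; first by move=> /= ->; exists [::], V.
  case: V => [|d V] /=; first by case=> ea; rewrite ea in fu.
  case=> ea; rewrite ea /= in fu * => /(IHu _ fu) [f [b [-> -> ->]]].
  by exists (d :: f), b.
- by move=> [-> /IH H] /H [a' [e [b [-> -> -> ->]]]]; exists (c :: a'), e, b.
Qed.

Lemma cells_prefix v w W x w' : map Cell v ++ w = map Cell W ++ Front x :: w' ->
  exists b, W = v ++ b.
Proof.
move=> e; have [|//||a [e' [b [ea ev eW _]]]] :=
  @cells_occurrence (map Cell v) [::] w w' W x; first exact: fronts_Cell.
- by [].
- by case: a ea eW => // _ ->; exists b; rewrite (inj_map Cell_inj ev).
Qed.

(** The cells at the beginning of a legitimate word belong to its first zone, whose hats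
    are its colour followed by the hats of what it has eaten; by induction these
    are the next colours. *)
Lemma legit_hats xs v w : legit xs (map Cell v ++ w) ->
  exists t, xs = hats v ++ t.
Proof.
move uE: (map Cell v ++ w) => u lu.
elim: lu v w uE => {xs u} [|x xs u lu IH|x xs v' u l h r lu IH z] v w e.
- by case: v e => // _; exists [::].
- by case: v e => // _; exists (x :: xs).
have [b eW] := cells_prefix e; have [t ->] := IH _ _ (erefl _).
have := zone_hats z; rewrite eW /hats pmap_cat -/(hats v) -/(hats b).
case: (hats v) => [|y hv] /=; first by exists (x :: hats v' ++ t).
by case=> -> <-; rewrite -catA; exists (hats b ++ t).
Qed.

Lemma squarefree_behead (T : Type) x (xs : seq T) :
  squarefree (x :: xs) -> squarefree xs.
Proof.
by rewrite -[x :: xs]cats0 -[_ ++ _]/([:: x] ++ xs ++ [::]) => /squarefree_infix.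
Qed.

Lemma legit_content_squarefree xs v w :
  squarefree xs -> squarefree (map Cell v ++ w) -> legit xs (map Cell v ++ w) ->
  squarefree v /\ squarefree (hats v).
Proof.
move=> sqx sqv lv; split.
  move=> p y q e; have : map Cell y = [::].
    by apply: (sqv (map Cell p) _ (map Cell q ++ w)); rewrite e !map_cat -!catA.
  by case: y {e}.
have [t et] := legit_hats lv.
by apply: (@squarefree_infix _ [::] _ t); rewrite -et.
Qed.

(** A square cannot contain a front or a base, because these spell [xs].  So it
    lies inside one zone.  The content of that zone is squarefree by induction,
    hence so is its text, and the square would repeat a cell without text. *)
Lemma legit_squarefree xs w : squarefree xs -> legit xs w -> squarefree w.
Proof.
move=> + lw; elim: (lw) => {xs w lw} [|x xs w lw IH|x xs v w l h r lw IH z] sqx.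
- by move=> [|? ?] [|? ?].
- have /IH {}IH := squarefree_behead sqx.
  move=> p y q e; have fy : pmap front y = [::].
    by apply: (squarefree_pmap _ e); rewrite (legit_fronts (legit_base x lw)).
  case: p e => [|a [|b p]] /=.
  + case: y fy => // a [|b y] fy; first by case=> <-.
    by case=> ea eb; rewrite -ea -eb in fy.
  + by case: y fy => // a' y fy [_ ea]; rewrite -ea in fy.
  + by case=> _ _ /IH.
have {}IH := IH (squarefree_behead sqx).
move=> p y q e; have fy : pmap front y = [::].
  by apply: (squarefree_pmap _ e); rewrite (legit_fronts (legit_zone lw z)).
have [le|gt] := leqP (size p) (size (l ++ h :: r)); last first.
  have [||p' _ e'] := @eq_cat_long _ p (y ++ y ++ q)
      (rcons (map Cell (l ++ h :: r)) (Front x)) w.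
  + by rewrite cat_rcons.
  + by rewrite size_rcons size_map.
  by apply: (IH (map Cell v ++ p') _ q); rewrite -e' !catA.
have [||a [yy [b [_ eyy eW _]]]] := @cells_occurrence (y ++ y) p q w _ x _ _ le.
- by rewrite pmap_cat fy.
- by rewrite e -catA.
have [c ey] : exists c, y = map Cell c.
  exists (take (size y) yy); apply: (@cat_injr _ _ _ y).
  rewrite {1}eyy -{1}(cat_take_drop (size y) yy) map_cat; congr cat.
  have : drop (size y) (y ++ y) = map Cell (drop (size y) yy).
    by rewrite eyy map_drop.
  by rewrite drop_size_cat.
have {}eyy : yy = c ++ c.
  by apply: (inj_map Cell_inj); rewrite -eyy map_cat ey.
have tc : pmap text c = [::].
  apply: (@squarefree_pmap _ _ text (l ++ h :: r) a c b).
    rewrite (zone_text z).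
    have [||sqv sqh] := legit_content_squarefree _ _ lw => //.
      exact: squarefree_behead sqx.
    exact: encode_squarefree.
  by rewrite eW eyy -catA.
have := zone_marks z; rewrite eW eyy -catA !marks_cat !catA.
have -> : marks c = c.
  elim: c tc {ey eyy} => //= f c IHc.
  by case: (text f) => //= /IHc; rewrite /marks => ->.
rewrite !cat_uniq; case: c ey {eyy tc} => [-> //|f c _].
by move=> /andP [/and3P [_ /hasP []]]; exists f; rewrite ?mem_cat ?inE ?eqxx ?orbT.
Qed.

(** * Relations that hold on legitimate words *)

(** Either side of the relation can be replaced by the other one in legitimate
    words.  The colours are required to be squarefree, for otherwise the
    relation that detects squares would not be valid. *)
Definition valid (u : seq letter) (o : option (seq letter)) : Prop :=
  forall xs, squarefree xs -> forall p q, legit xs (p ++ u ++ q) <->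
    (if o is Some v then legit xs (p ++ v ++ q) else False).

Lemma legit_cells (u u' : seq cell) : u <> [::] ->
  (forall x v l h r a b, zone x v l h r -> l ++ h :: r = a ++ u ++ b ->
     exists l' h' r', zone x v l' h' r' /\ l' ++ h' :: r' = a ++ u' ++ b) ->
  forall xs p q, legit xs (p ++ map Cell u ++ q) ->
    legit xs (p ++ map Cell u' ++ q).
Proof.
move=> u0 H; apply: legit_occurrence.
- by case: u u0 {H}.
- move=> x xs w [|a [|b p]] q _ //.
    by case: u u0 {H} => // c u _ [].
  by case: u u0 {H} => // c u _ [].
- move=> x xs v w l h r p q lw z e le.
  have [|a [f [b [-> /(inj_map Cell_inj) uf eW ->]]]] := cells_occurrence _ e le.
    by rewrite fronts_Cell.
  rewrite -{f}uf in eW; have [l' [h' [r' [z' eW']]]] := H _ _ _ _ _ _ _ z eW.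
  rewrite !catA -!map_cat -catA -eW'; exact: legit_zone z'.
- by move=> x xs p q; exact: legit_base.
- move=> x xs v l h r p q z lw; rewrite -catA; apply: legit_zone z.
  by rewrite -catA in lw.
Qed.

Lemma valid_cells_none (u : seq cell) : u <> [::] ->
  (forall x v l h r a b, squarefree v -> squarefree (hats v) ->
     zone x v l h r ->
     l ++ h :: r <> a ++ u ++ b) ->
  valid (map Cell u) None.
Proof.
move=> u0 H xs sqx p q; split=> // lw; move: xs p q lw sqx.
apply: (@legit_occurrence _ (fun xs _ _ => squarefree xs -> False)).
- by case: u u0 {H}.
- move=> x xs w p q _.
  by case: p => [|a [|b p]] //; case: u u0 {H} => // c u _ [].
- move=> x xs v w l h r p q lw z e le sqx.
  have [|a [f [b [_ /(inj_map Cell_inj) uf eW _]]]] := cells_occurrence _ e le.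
    by rewrite fronts_Cell.
  move: (squarefree_behead sqx) => {}sqx.
  rewrite -{f}uf in eW.
  have [sqv sqh] := legit_content_squarefree sqx (legit_squarefree sqx lw) lw.
  exact: H sqv sqh z eW.
- by move=> x xs _ _ H' sqx; exact: H' (squarefree_behead sqx).
- by move=> x xs v l h r _ _ _ H' sqx; exact: H' (squarefree_behead sqx).
Qed.

Lemma valid_front_none (u : seq cell) g :
  (forall v l h r a, zone g v l h r -> l ++ h :: r <> a ++ u) ->
  valid (map Cell u ++ [:: Front g]) None.
Proof.
move=> H xs _ p q; split=> //.
apply: (@legit_occurrence _ (fun _ _ _ => False)) => //.
- by case: u {H}.
- move=> x {}xs w {p q} [|a [|b p]] q _ //.
    by case: u {H} => [|c u] [].
  by case: u {H} => [|c u] [].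
- move=> x {}xs v w l h r {}p {}q lw z; rewrite -catA => e le.
  have [|a [f [b [_ /(inj_map Cell_inj) uf eW]]]] := cells_occurrence _ e le.
    by rewrite fronts_Cell.
  case: b eW => //; rewrite cats0 -uf => eW [eg _].
  by rewrite -eg in z; exact: H z eW.
Qed.

Lemma zone_at_head x v l k r a h b : zone x v l k r -> is_head h ->
  l ++ k :: r = a ++ h :: b -> zone x v a h b.
Proof.
move=> z hh e; have [hk hl hr] := zone_heads z.
by have [-> -> ->] := head_split hh hk hl hr (esym e).
Qed.

Lemma valid_head_none p h q : is_head h ->
  (forall x v a b, squarefree v -> squarefree (hats v) ->
     ~ zone x v (a ++ p) h (q ++ b)) ->
  valid (map Cell (p ++ h :: q)) None.
Proof.
move=> hh H; apply: valid_cells_none => [|x v l k r a b sqv sqh z e].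
  by case: p {H}.
by apply: (H x v a b sqv sqh); apply: zone_at_head z hh _; rewrite e -!catA.
Qed.

(** A move changes one zone without changing its content, so it affects
    legitimacy neither way. *)
Lemma valid_move p h q p' h' q' : move p h q p' h' q' ->
  valid (map Cell (p ++ h :: q)) (Some (map Cell (p' ++ h' :: q'))).
Proof.
move=> m xs _ a b; have [hh hh' _ _] := move_heads m.
split; apply: legit_cells => [|x v l k r c d z e]; do 1?by [case: p {m} | case: p' {m}].
  exists (c ++ p'), h', (q' ++ d); rewrite -!catA; split=> //.
  apply/(zone_move x v c d m); apply: zone_at_head z hh _.
  by rewrite e -!catA.
exists (c ++ p), h, (q ++ d); rewrite -!catA; split=> //.
apply/(zone_move x v c d m); apply: zone_at_head z hh' _.
by rewrite e -!catA.
Qed.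

Lemma encode_nil v : encode v = [::] -> v = [::].
Proof. by case: v => // e v; rewrite /encode /= /code; case: (hat e). Qed.

(** From right to left: a head at rest next to its front has an empty text, so
    that its front has eaten nothing. *)
Lemma valid_start x :
  valid [:: Start; Base x] (Some [:: Cell (Root x); Front x]).
Proof.
move=> xs _ p q; split; move: xs p q; apply: legit_occurrence => //.
- move=> y xs w p q lw; case: p => [|a [|b p]] //= [ex ew] _.
  by rewrite ex ew; apply: (@legit_zone y xs [::] w [::] (Root y) [::]).
- move=> y xs v w l h r p q lw z e le.
  by have [|a [[|f s] [b [_ //]]]] := @cells_occurrence [:: Start] _ _ _ _ _ _ e le.
- by move=> y xs p q; exact: legit_base.
- move=> y xs v l h r p q z lw; rewrite -catA; apply: legit_zone z.
  by rewrite -catA in lw.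
- by move=> y xs w [|a [|b p]] q lw.
- move=> y xs v w l h r p q lw z e le.
  have [|a [f [b [-> ef eW eq]]]] :=
    @cells_occurrence [:: Cell (Root x)] _ _ _ _ _ _ e le => //.
  case: b eW eq => // eW [ex ew]; case: f ef eW => // f [|//] [<-] eW.
  have [exy ea ev] := @zone_at_head _ _ _ _ _ _ (Root x) _ z isT eW.
  have v0 : v = [::] by apply: encode_nil; case: (encode v) ev.
  by rewrite ea -ex; apply: legit_base; rewrite v0 -ew in lw.
- by move=> y xs p q; exact: legit_base.
- move=> y xs v l h r p q z lw; rewrite -catA; apply: legit_zone z.
  by rewrite -catA in lw.
Qed.

Lemma headless_tail l h r a t : is_head h -> has is_head t = false ->
  l ++ h :: r = a ++ t -> exists2 r', a = l ++ h :: r' & r = r' ++ t.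
Proof.
move=> hh ht e; have [le|gt] := leqP (size a) (size l).
  have [l' _ e'] := eq_cat_long e le.
  by move: ht; rewrite -e' has_cat /= hh orbT.
have [||r' -> e'] := @eq_cat_long _ a t (rcons l h) r.
- by rewrite cat_rcons e.
- by rewrite size_rcons.
by exists r'; rewrite ?cat_rcons.
Qed.

Lemma valid_eat x e : valid [:: Front x; Cell e]
  (Some (map Cell (map Rgt (code e)) ++ [:: Front x])).
Proof.
move=> xs _ p q; split; move: xs p q; apply: legit_occurrence => //.
- by move=> y xs w [|a [|b p]] q lw.
- move=> y xs v w l h r p q lw z E le.
  have [|a [f [b [-> ef eW eq]]]] :=
    @cells_occurrence [::] _ _ _ _ _ _ E le => //.
  case: f ef eW => // _ eW.
  case: b eW eq => // eW [ex ew]; rewrite !cats0 in eW.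
  rewrite -ex in z *; rewrite -ew in lw; rewrite -eW.
  rewrite !catA -map_cat -catA /= -catA /=.
  apply: legit_zone (zone_eat _ z); by rewrite map_rcons cat_rcons.
- by move=> y xs p q; exact: legit_base.
- move=> y xs v l h r p q z lw; rewrite -catA; apply: legit_zone z.
  by rewrite -catA in lw.
- by case: (code e).
- move=> y xs w [|a [|b p]] q lw //; rewrite /code;
  by case: (hat e).
- move=> y xs v w l h r p q lw z; rewrite -catA => E le.
  have [|a [f [b [-> /(inj_map Cell_inj) <- eW eq]]]] := cells_occurrence _ E le.
    by rewrite fronts_Cell.
  case: b eW eq => // eW [ex ew]; rewrite !cats0 in eW.
  have [hh hl hr] := zone_heads z.
  have [r' -> er] := headless_tail hh (Rgt_headless _) eW.
  rewrite er in z; have [v' ev z'] := zone_uneat z.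
  rewrite -ex in z' *; apply: legit_zone z'.
  by move: lw; rewrite -ew ev map_rcons cat_rcons.
- by move=> y xs p q; exact: legit_base.
- move=> y xs v l h r p q z lw; rewrite -catA; apply: legit_zone z.
  by rewrite -catA in lw.
Qed.

(** * Words that occur in no legitimate word *)

Lemma zone_first x v l h r : zone x v l h r ->
  exists w, l ++ h :: r = Root x :: w \/ l ++ h :: r = Open x :: w.
Proof.
case: h => //=.
- by move=> y [-> -> _]; exists r; left.
- by move=> [A [B [_ -> _]]]; eexists; right.
- by move=> d [A [B [C [_ -> _]]]]; eexists; right.
- by move=> d [A [B [C [D [_ _ -> _]]]]]; eexists; right.
- by move=> d s [A [B [C [D [u1 [u2 [_ _ _ -> _]]]]]]]; eexists; right.
- by move=> d [A [B [C [s [D [u1 [u2 [_ _ _ -> _]]]]]]]]; eexists; right.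
Qed.

Lemma legit_first xs a w : legit xs (a :: w) ->
  a = Start \/ exists x, a = Cell (Root x) \/ a = Cell (Open x).
Proof.
move uE: (a :: w) => u lu; case: lu uE => {xs u} //.
- by move=> x xs u _ [-> _]; left.
- move=> x xs v u l h r _ z; have [W eW] := zone_first z.
  by case: eW => -> [-> _]; right; exists x; [left | right].
Qed.

Lemma legit_before_base xs p x q :
  legit xs (p ++ Base x :: q) -> exists p', p = rcons p' Start.
Proof.
move uE: (p ++ Base x :: q) => u lu; elim: lu p uE => {xs u}.
- by case.
- move=> y xs u _ IH [|a [|b p]] //=; first by case=> ->; exists [::].
  by case=> -> -> /IH [p' ->]; exists [:: Start, Base y & p'].
- move=> y xs v u l h r _ IH z p e.
  have [le|gt] := leqP (size p) (size (l ++ h :: r)).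
    have [|a [f [b [_ ef _ eq]]]] := @cells_occurrence [::] _ _ _ _ _ _ e le => //.
    by case: b eq.
  have [||p' ep e'] := @eq_cat_long _ p (Base x :: q) (rcons (map Cell (l ++ h :: r)) (Front y)) u.
  + by rewrite cat_rcons.
  + by rewrite size_rcons size_map.
  have /IH [s] : (map Cell v ++ p') ++ Base x :: q = map Cell v ++ u by rewrite -catA e'.
  rewrite ep; case/lastP: p' {e' ep} => [|p' a].
    rewrite cats0; case/lastP: (v) => [|v' c]; first by case: s.
    by rewrite map_rcons => /rcons_inj [].
  rewrite -rcons_cat => /rcons_inj [_ ->].
  by exists (rcons (map Cell (l ++ h :: r)) (Front y) ++ p'); rewrite rcons_cat.
Qed.

Lemma none_before_base a x : a <> Start -> valid [:: a; Base x] None.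
Proof.
move=> na xs _ p q; split=> //.
rewrite -[_ ++ _ ++ q]/(p ++ [:: a] ++ Base x :: q) catA cats1.
by move=> /legit_before_base [p' /rcons_inj [_]].
Qed.

Lemma none_after_start a : (forall x, a <> Base x) -> valid [:: Start; a] None.
Proof.
move=> na xs _ p q; split=> //; move: xs p q; apply: legit_occurrence => //.
- by move=> x xs w [|b [|c p]] q lw // [/na].
- move=> x xs v w l h r p q lw z e le.
  by have [|b [[|f s] [b' [_ //]]]] := @cells_occurrence [:: Start] _ _ _ _ _ _ e le.
Qed.

Lemma none_after_home x y a :
  match a with
  | Start | Cell (Root _) | Cell (Open _) => False | _ => True
  end -> valid [:: Cell (Root x); Front y; a] None.
Proof.
move=> na xs _ p q; split=> //; move: xs p q; apply: legit_occurrence => //.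
- by move=> z xs w [|b [|c p]] q.
- move=> z xs v w l h r p q lw zo e le.
  have [|b [f [b' [_ ef eW eq]]]] :=
    @cells_occurrence [:: Cell (Root x)] _ _ _ _ _ _ e le => //.
  case: b' eW eq => // eW [_ ew]; case: f ef eW => // f [|//] [<-] eW.
  have [_ _ ev] := @zone_at_head _ _ _ _ _ _ (Root x) _ zo isT eW.
  have v0 : v = [::] by apply: encode_nil; case: (encode v) ev.
  move: lw; rewrite v0 -ew /= => /legit_first [ea|[t [ea|ea]]];
    by rewrite ea in na.
Qed.

Lemma none_wrong_home x y : x <> y -> valid [:: Cell (Root x); Front y] None.
Proof.
move=> ne; apply: (@valid_front_none [:: Root x]) => v l h r a z e.
by have [] := @zone_at_head _ _ _ _ _ _ (Root x) [::] z isT e.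
Qed.

Lemma none_after_scan e : (forall s, e <> Rgt s) ->
  valid (map Cell [:: Scan; e]) None.
Proof.
move=> ne; apply: (@valid_head_none [::]) => // x v a b _ _ [A [B [_ _]]].
by case: B => //= s B [/ne].
Qed.

Lemma none_root_short x y w : w <> [::] ->
  (forall e w', w <> w' ++ code e) ->
  valid (map Cell (Root x :: map Rgt w) ++ [:: Front y]) None.
Proof.
move=> w0 nw; apply: valid_front_none => v l h r a z e.
have [_ _ /(inj_map Rgt_inj) E] := @zone_at_head _ _ _ _ _ _ (Root x) _ z isT e.
case/lastP: v E {z} => [//|v f]; rewrite encode_rcons; exact: nw.
Qed.

Lemma size_code e : 2 < size (code e) < 5.
Proof. by rewrite /code; case: (hat e). Qed.

(** A code has at most four symbols, so the last four symbols before a front end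
    in the code of the last cell that it ate. *)
Lemma none_tail y w : 3 < size w ->
  (forall e w', w <> w' ++ code e) ->
  valid (map Cell (map Rgt w) ++ [:: Front y]) None.
Proof.
move=> lt_w nw; apply: valid_front_none => v l h r a z e.
have [hh _ _] := zone_heads z.
have [r' _ er] := headless_tail hh (Rgt_headless _) e.
have [T ET] : exists T, encode v = T ++ w.
  move: z; rewrite er; case: h hh {er e} => //=.
  - by move=> t _ [_ _ /cat_Rgt [B -> _]]; exists B.
  - by move=> _ [A [B [-> _ /cat_Rgt [B' -> _]]]]; exists (A ++ B'); rewrite catA.
  - move=> d _ [A [B [C [-> _ /cat_Rgt [B' -> _]]]]].
    by exists (A ++ B ++ B'); rewrite !catA.
  - move=> d _ [A [B [C [D [-> _ _ /cat_Rgt [B' -> _]]]]]].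
    by exists (A ++ B ++ C ++ B'); rewrite !catA.
  - move=> d s _ [A [B [C [D [u1 [u2 [-> _ _ _ /cat_Rgt_held [B' -> _]]]]]]]].
    by exists (A ++ B ++ C ++ s :: B'); rewrite -!catA.
  - move=> d _ [A [B [C [s [D [u1 [u2 [-> _ _ _ /cat_Rgt_held [B' -> _]]]]]]]]].
    by exists (A ++ B ++ C ++ s :: B'); rewrite -!catA.
case/lastP: v ET {z e} => [|v f]; first by case: T => //; case: (w) lt_w.
rewrite encode_rcons => E; have /andP [_ lt_f] := size_code f.
have [|w' _ ew] := @eq_cat_long _ (encode v) (code f) T w E.
  move/(congr1 size): E; rewrite !size_cat => E.
  rewrite -(leq_add2r (size (code f))) E leq_add2l.
  by rewrite ltnS in lt_f; exact: leq_trans lt_f lt_w.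
by apply: (nw f w'); rewrite ew.
Qed.

Definition is_left (e : cell) : bool :=
  match e with Lft _ | MarkI | MarkJ true => true | _ => false end.

Lemma opened_left x A u : all is_left (behead (opened x A u)).
Proof.
by rewrite /opened /= all_cat /= !all_map; apply/andP; split;
  apply/allP=> [[]].
Qed.

Lemma zone_left x v l h r : zone x v l h r ->
  [/\ all is_left (behead l), if l is e :: _ then e = Open x else h = Root x,
      ~~ has is_left r & ~~ has (fun e => if e is Open _ then true else false) r].
Proof.
have R B : ~~ has is_left (map Rgt B) by rewrite has_map; apply/hasPn.
have O B : ~~ has (fun e => if e is Open _ then true else false) (map Rgt B).
  by rewrite has_map; apply/hasPn.
have Ru u : ~~ has is_left (map rcell u) by rewrite has_map; apply/hasPn=> [[]].
have Ou u : ~~ has (fun e => if e is Open _ then true else false) (map rcell u).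
  by rewrite has_map; apply/hasPn=> [[]].
case: h => //=.
- by move=> y [-> -> ->].
- move=> [A [B [_ -> ->]]]; split=> //=; rewrite all_map; exact/allP.
- by move=> d [A [B [C [_ -> ->]]]]; split=> //; exact: opened_left.
- by move=> d [A [B [C [D [_ _ -> ->]]]]]; split=> //; exact: opened_left.
- move=> d s [A [B [C [D [u1 [u2 [_ _ _ -> ->]]]]]]].
  split=> //; first exact: opened_left.
    by rewrite has_cat negb_or Ru /= R.
  by rewrite has_cat negb_or Ou /= O.
- move=> d [A [B [C [s [D [u1 [u2 [_ _ _ -> ->]]]]]]]].
  split=> //; first exact: opened_left.
    by rewrite has_cat negb_or Ru /= R.
  by rewrite has_cat negb_or Ou /= O.
Qed.

Definition is_open (e : cell) : bool := if e is Open _ then true else false.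

(** All the cells on the left of the head, and only they, show that the head is
    on their right; between the last of them and the cells on the right of the
    head there must be a head other than a root. *)
Lemma none_after_left e f :
  is_left e || is_open e -> ~~ is_left f ->
  ~~ is_head f || (if f is Root _ then true else false) ->
  valid (map Cell [:: e; f]) None.
Proof.
move=> le lf hf; apply: valid_cells_none => // x v l h r a b _ _ z E.
have [hh _ _] := zone_heads z; have [ll l0 lr lo] := zone_left z.
have [le_l|gt_l] := leqP (size l) (size a).
  have [[|c a'] _] := eq_cat_long (esym E) le_l.
    by case=> eh; rewrite -eh in hh; case: (e) le hh.
  case=> _ er; case/orP: le => [le|oe].
    by move: lr; rewrite -er has_cat /= le orbT.
  by move: lo; rewrite -er has_cat /= -/(is_open e) oe orbT.
have [||l' el E'] := @eq_cat_long _ l (h :: r) (rcons a e) (f :: b).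
- by rewrite E cat_rcons.
- by rewrite size_rcons.
case: l' el E' => [|c l'] el [eh _].
  case/orP: hf => [|rf]; first by rewrite -eh hh.
  by case: f rf {lf E} eh => // y _ eh; move: z; rewrite eh el /= => -[_]; case: (a).
move: ll; rewrite el eh; case: (a) => [|d s] /=; first by rewrite (negbTE lf).
by rewrite cat_rcons all_cat /= (negbTE lf) /= !andbF.
Qed.

Lemma none_left_end e g : is_left e || is_open e ->
  valid [:: Cell e; Front g] None.
Proof.
move=> le; apply: (@valid_front_none [:: e]) => v l h r a z.
have [hh _ _] := zone_heads z; have [_ _ lr lo] := zone_left z.
case/lastP: r lr lo {z} => [|r c].
  move=> _ _; rewrite !cats1 => /rcons_inj [_ eh].
  by rewrite eh in hh; case: (e) le hh.
rewrite !has_rcons !negb_or -rcons_cons -rcons_cat cats1.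
move=> /andP [lc _] /andP [oc _] /rcons_inj [_ ec].
by move: le; rewrite -ec (negbTE lc) /is_open (negbTE oc).
Qed.

Lemma none_before_scan e : e = MarkI \/ (exists b, e = MarkJ b) ->
  valid (map Cell [:: e; Scan]) None.
Proof.
move=> he; apply: (@valid_head_none [:: e]) => // x v a b _ _ [A [B [_ + _]]].
by case: he => [->|[c ->]]; case/last_scannedP.
Qed.

Lemma none_before_place e d : e = MarkJ true \/ (exists x, e = Open x) ->
  valid (map Cell [:: e; Place d]) None.
Proof.
move=> he; apply: (@valid_head_none [:: e]) => // x v a b _ _.
move=> [A [B [C [_ + _]]]].
case/last_openedP=> [_ ee _|u o eB ee _]; first by case: he => [|[y]]; rewrite ee.
case/lastP: B eB => [|B s]; first by case: u.
rewrite map_rcons => /rcons_inj [_ eo].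
by case: he => [|[y]]; rewrite ee -eo.
Qed.

Lemma none_before_ready e d : e = MarkI \/ (exists x, e = Open x) ->
  valid (map Cell [:: e; Ready d]) None.
Proof.
move=> he; apply: (@valid_head_none [:: e]) => // x v a b _ _.
move=> [A [B [C [D [_ _ + _]]]]].
case/last_openedP=> [eB _ _|u o _ ee _]; first by case: B eB.
by case: he => [|[y]]; rewrite ee; case: o {ee}.
Qed.

Lemma none_open_back x d : valid (map Cell [:: Open x; Back d]) None.
Proof.
apply: (@valid_head_none [:: Open x]) => // y v a b _ _.
move=> [A [B [C [s [D [u1 [u2 [_ _ _ + _]]]]]]]].
by case/last_openedP=> // u o _; case: o.
Qed.

(** While the head goes back, the mark I has just passed the symbol that was
    matched and possibly some untracked ones, so the cell before I is a symbol. *)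
Lemma none_mark_back e d :
  (exists b, e = MarkJ b) \/ e = MarkI \/ (exists x, e = Open x) ->
  valid (map Cell [:: e; MarkI; Back d]) None.
Proof.
move=> he; apply: (@valid_head_none [:: e; MarkI]) => // y v a b _ _.
move=> [A [B [C [s [D [u1 [u2 [E [ts eA] eu + _]]]]]]]].
rewrite -[[:: e; MarkI]]/([:: e] ++ [:: MarkI]) catA.
case/last_openedP=> [_ _|? [?|] ? //].
case/last_scannedP=> [eA0 _ _|A' t _ ee _].
  case: eA => w; rewrite eA0 track_rcons ts => /(congr1 size).
  by rewrite size_cat size_rcons addnS.
by case: he => [[c]|[|[c]]]; rewrite ee.
Qed.

Lemma none_after_carry d s e :
  (forall t, e <> Rgt t) -> e <> MarkJ false -> e <> Held s ->
  valid (map Cell [:: Carry d s; e]) None.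
Proof.
move=> nr nj nh; apply: (@valid_head_none [::]) => // x v a b _ _.
move=> [A [B [C [D [u1 [u2 [_ _ _ _]]]]]]].
by case: u2 => [|[t|] u2] /= [e_ _]; [case: nh | case: (nr t) | case: nj].
Qed.

Lemma none_carry_end d s g : valid [:: Cell (Carry d s); Front g] None.
Proof.
apply: (@valid_front_none [:: Carry d s]) => v l h r a z e.
have [A [B [C [D [u1 [u2 [_ _ _ _]]]]]]] :=
  @zone_at_head _ _ _ _ _ _ (Carry d s) [::] z isT e.
by case: u2.
Qed.

Lemma track_encode_squarefree d v :
  squarefree v -> squarefree (hats v) -> squarefree (track d (encode v)).
Proof.
move=> sqv sqh; case: d.
  rewrite /track (@eq_filter _ _ predT) // filter_predT.
  exact: encode_squarefree.
move=> p y q e; have : pmap symbol_hat y = [::].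
  apply: (squarefree_pmap _ e).
  suff -> : pmap symbol_hat (track false (encode v)) = hats v by [].
  rewrite -encode_hats; elim: (encode v) => //= [[x|z] T] /= -> //.
have : all (tracked false) y.
  have := filter_all (tracked false) (encode v); rewrite -/(track _ _) e !all_cat.
  by case/and3P.
by case: y {e} => // [[]].
Qed.

(** When the mark I reaches the mark J, the tracked symbols compared so far
    stand on both sides of them.  The text of a zone has no square, in either
    mode. *)
Lemma none_square d :
  valid (map Cell [:: MarkI; Back d; MarkJ false]) None.
Proof.
apply: (@valid_head_none [:: MarkI] (Back d) [:: MarkJ false]) => //.
move=> x v a b sqv sqh.
move=> [A [B [C [s [D [u1 [u2 [E [ts [w ew]] eu + er]]]]]]]].
case/last_openedP=> [eu1 _ _|? [?|] ? //].
rewrite {}eu1 in eu; case: u2 eu er => [|[t|] u2] // eu _.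
have B0 : B = [::] by case: B eu {E}.
have : track d (rcons C s) = [::].
  apply: (track_encode_squarefree (d := d) sqv sqh (p := w) (q := track d D)).
  rewrite E B0 /= -cat_rcons /track !filter_cat -/(track d A) ew -catA.
  by [].
by rewrite track_rcons ts; case: (track d C).
Qed.

Lemma none_untracked_carry d s : ~~ tracked d s ->
  valid (map Cell [:: Carry d s]) None.
Proof.
move=> nt; apply: (@valid_head_none [::] _ [::]) => // x v a b _ _.
move=> [A [B [C [D [u1 [u2 [_ [ts _] _ _ _]]]]]]].
by rewrite ts in nt.
Qed.

(** * The semigroup *)

Definition short_words : seq (word letter) :=
  pmap insub (flatten
    [seq [seq val t | t : n.-tuple letter] | n <- iota 1 5]).

Lemma mem_short_words (u : word letter) : size u <= 5 -> u \in short_words.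
Proof.
move=> le_u; rewrite mem_pmap; apply/mapP; exists (val u); last by rewrite valK.
apply/flatten_mapP; exists (size u).
  by rewrite mem_iota; move: (valP u) le_u; rewrite /nilp /=; case: (size u).
by apply/mapP; exists (in_tuple u); rewrite ?mem_enum.
Qed.

(** The rules and the forbidden words of the machine have length at most 5;
    taking all valid relations of this size makes the soundness of the
    presentation immediate. *)
Definition valid_relations : seq (word letter * option (word letter)) :=
  filter (fun r : word letter * option (word letter) =>
      `[< valid r.1 (omap (@letters letter) r.2) >])
    [seq (u, o) | u <- short_words, o <- None :: map Some short_words].

Definition squares : presentation := Presentation valid_relations.

Lemma pres_valid (u : word letter) (o : option (word letter)) :
  size u <= 5 -> (if o is Some v then size v <= 5 else true) ->
  valid u (omap (@letters letter) o) ->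
  @pres_eq squares (Some u) o.
Proof.
move=> le_u le_o uo; apply: (@pres_rel squares (u, o)).
have : (u, o) \in valid_relations; last by [].
rewrite mem_filter; apply/andP; split; first exact/asboolP.
apply: allpairs_f; first exact: mem_short_words.
case: o le_o {uo} => [v le_v|_]; rewrite in_cons //=.
by rewrite map_f // mem_short_words.
Qed.

Definition legit_in xs p q (o : option (word letter)) : Prop :=
  if o is Some u then legit xs (p ++ u ++ q) else False.

(** Legitimacy in a context is a congruence invariant by the choice of the
    relations. *)
Lemma pres_eq_legit x y : @pres_eq squares x y ->
  forall xs, squarefree xs -> forall p q, legit_in xs p q x <-> legit_in xs p q y.
Proof.
elim=> {x y} [r rin|//|x y _ IH|y x z _ IHxy _ IHyz|x x' y y' _ IHx _ IHy] xs sqx p q.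
- have {rin} : (r : word letter * option (word letter)) \in valid_relations by [].
  rewrite mem_filter => /andP [/asboolP H _]; have := H xs sqx p q.
  by case: (r.2).
- by rewrite IH.
- by rewrite IHxy // IHyz.
have {}IHx := IHx xs sqx; have {}IHy := IHy xs sqx.
case: x y x' y' IHx IHy => [u|] [v|] [u'|] [v'|] IHx IHy //=; rewrite -?catA.
- apply: iff_trans (IHx p (v ++ q)) _ => /=.
  by have /= := IHy (p ++ u') q; rewrite -!catA.
- apply: iff_trans (IHx p (v ++ q)) _ => /=.
  by have /= := IHy (p ++ u') q; rewrite -!catA.
- exact: (IHx p (v ++ q)).
- exact: (IHx p (v ++ q)).
- apply: iff_trans _ (IHx p (v' ++ q)) => /=.
  by have /= := IHy (p ++ u) q; rewrite -!catA.
- exact: (IHx p (v' ++ q)).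
- exact: (IHx p (v' ++ q)).
Qed.

Definition zero (w : seq letter) : Prop :=
  exists2 u : word letter, letters u = w & @pres_eq squares (Some u) None.

(** Contexts may be empty, but words are not. *)
Definition prepend (p : seq letter) (o : option (word letter)) :=
  if insub p is Some u then word0_mul (Some u) o else o.

Definition append (q : seq letter) (o : option (word letter)) :=
  if insub q is Some u then word0_mul o (Some u) else o.

Lemma prepend_letters p u : omap (@letters letter) (prepend p (Some u)) = Some (p ++ u).
Proof. by rewrite /prepend; case: insubP => [v _ <-|] //=; case: p. Qed.

Lemma append_letters q u : omap (@letters letter) (append q (Some u)) = Some (u ++ q).
Proof.
rewrite /append; case: insubP => [v _ <-|] //=; case: q => //.
by rewrite cats0.
Qed.

Lemma pres_context p q x y : @pres_eq squares x y ->
  @pres_eq squares (prepend p (append q x)) (prepend p (append q y)).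
Proof.
move=> xy; have {}xy : @pres_eq squares (append q x) (append q y).
  by rewrite /append; case: insub => // u; apply: pres_mul xy (pres_refl _).
by rewrite /prepend; case: insub => // u; apply: pres_mul (pres_refl _) xy.
Qed.

Lemma context_letters p q (u : word letter) : exists2 w : word letter,
  prepend p (append q (Some u)) = Some w & letters w = p ++ u ++ q.
Proof.
have := append_letters q u; case: (append q _) => //= v [ev].
have := prepend_letters p v; case: (prepend p _) => //= w [ew].
by exists w; rewrite // ew ev.
Qed.

Lemma context_none p q : prepend p (append q None) = None.
Proof. by rewrite /prepend /append; case: insub => [?|]; case: insub. Qed.

Lemma letters_inj : injective (@letters letter).
Proof. exact: val_inj. Qed.

(** Together with [zero_some], this is how the relations enter the proof that
    squares vanish. *)
Lemma zero_none u p q : 0 < size u <= 5 -> valid u None -> zero (p ++ u ++ q).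
Proof.
move=> /andP [u0 le_u] vu; have nu : ~~ nilp u by rewrite /nilp -lt0n.
have [w ew lw] := context_letters p q (Word nu); exists w => //.
rewrite -ew -(context_none p q); apply: pres_context.
exact: (@pres_valid (Word nu) None).
Qed.

Lemma zero_some u v p q : 0 < size u <= 5 -> 0 < size v <= 5 ->
  valid u (Some v) -> zero (p ++ u ++ q) <-> zero (p ++ v ++ q).
Proof.
move=> /andP [u0 le_u] /andP [v0 le_v] uv.
have nu : ~~ nilp u by rewrite /nilp -lt0n.
have nv : ~~ nilp v by rewrite /nilp -lt0n.
have [w ew lw] := context_letters p q (Word nu).
have [t et lt] := context_letters p q (Word nv).
have wt : @pres_eq squares (Some w) (Some t).
  rewrite -ew -et; apply: pres_context.
  exact: (@pres_valid (Word nu) (Some (Word nv))).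
rewrite -[u]/(letters (Word nu)) -[v]/(letters (Word nv)) -lw -lt.
split=> -[s /letters_inj -> s0].
  by exists t => //; apply: pres_trans s0; apply: pres_sym.
by exists w => //; apply: pres_trans s0.
Qed.

(** * Running the machine *)

Section Machine.

Variables P Q : seq letter.

Definition dead (w : seq cell) : Prop := zero (P ++ map Cell w ++ Q).

Lemma step p h q p' h' q' l r : move p h q p' h' q' ->
  dead (l ++ p ++ h :: q ++ r) <-> dead (l ++ p' ++ h' :: q' ++ r).
Proof.
move=> m; have := valid_move m; rewrite /dead.
have -> : P ++ map Cell (l ++ p ++ h :: q ++ r) ++ Q =
    (P ++ map Cell l) ++ map Cell (p ++ h :: q) ++ map Cell r ++ Q.
  by rewrite !(map_cat, map_cons) -!catA /= -!catA.
have -> : P ++ map Cell (l ++ p' ++ h' :: q' ++ r) ++ Q =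
    (P ++ map Cell l) ++ map Cell (p' ++ h' :: q') ++ map Cell r ++ Q.
  by rewrite !(map_cat, map_cons) -!catA /= -!catA.
by apply: zero_some; case: m.
Qed.

Lemma dead_none u l r : 0 < size u <= 5 -> valid (map Cell u) None ->
  dead (l ++ u ++ r).
Proof.
move=> su vu; rewrite /dead.
have -> : P ++ map Cell (l ++ u ++ r) ++ Q =
    (P ++ map Cell l) ++ map Cell u ++ map Cell r ++ Q.
  by rewrite !map_cat -!catA.
by apply: zero_none; rewrite ?size_map.
Qed.

Lemma sweep_scan l B r :
  dead (l ++ Scan :: map Rgt B ++ r) <-> dead (l ++ map Lft B ++ Scan :: r).
Proof.
elim: B l => //= s B IH l.
rewrite (step l (map Rgt B ++ r) (move_scan s)) /=.
by have := IH (rcons l (Lft s)); rewrite !cat_rcons.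
Qed.

Lemma sweep_place d l B r :
  dead (l ++ Place d :: map Rgt B ++ r) <->
  dead (l ++ map Lft B ++ Place d :: r).
Proof.
elim: B l => //= s B IH l.
rewrite (step l (map Rgt B ++ r) (move_place d s)) /=.
by have := IH (rcons l (Lft s)); rewrite !cat_rcons.
Qed.

Lemma sweep_ready d l N r : all (predC (tracked d)) N ->
  dead (l ++ Ready d :: map Rgt N ++ r) <->
  dead (l ++ map Lft N ++ Ready d :: r).
Proof.
elim: N l => //= s N IH l /andP [ns /IH {}IH].
rewrite (step l (map Rgt N ++ r) (move_skip ns)) /=.
by have := IH (rcons l (Lft s)); rewrite !cat_rcons.
Qed.

Lemma sweep_back d l u r :
  dead (l ++ Back d :: map rcell u ++ r) <->
  dead (l ++ map lcell u ++ Back d :: r).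
Proof.
elim: u l => //= o u IH l.
rewrite (step l (map rcell u ++ r) (move_back d o)) /=.
by have := IH (rcons l (lcell o)); rewrite !cat_rcons.
Qed.

Lemma sweep_carry d s l u r :
  dead (l ++ map lcell u ++ Carry d s :: r) <->
  dead (l ++ Carry d s :: map rcell u ++ r).
Proof.
elim: u l => //= o u IH l.
rewrite -(step l (map rcell u ++ r) (move_carry d s o)) /=.
by have := IH (rcons l (lcell o)); rewrite !cat_rcons.
Qed.

Lemma sweep_hop d l N r : all (predC (tracked d)) N ->
  dead (l ++ MarkI :: Back d :: map Rgt N ++ r) <->
  dead (l ++ map Lft N ++ MarkI :: Back d :: r).
Proof.
elim: N l => //= s N IH l /andP [ns /IH {}IH].
rewrite (step l (map Rgt N ++ r) (move_hop ns)) /=.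
by have := IH (rcons l (Lft s)); rewrite !cat_rcons.
Qed.

Lemma map_lcell_Some A : map lcell (map Some A) = map Lft A.
Proof. by elim: A => //= s A ->. Qed.

Lemma map_rcell_Some A : map rcell (map Some A) = map Rgt A.
Proof. by elim: A => //= s A ->. Qed.

Lemma run_home x T r : dead (Root x :: map Rgt T ++ r) <->
  dead (Open x :: map Lft T ++ Scan :: r).
Proof.
rewrite (step [::] (map Rgt T ++ r) (move_open x)) /=.
exact: (sweep_scan [:: Open x]).
Qed.

Lemma untracked_prefix d B : exists N B',
  [/\ B = N ++ B', all (predC (tracked d)) N &
      if B' is s :: _ then tracked d s else true].
Proof.
elim: B => [|s B [N [B' [-> aN hB]]]]; first by exists [::], [::].
case ts: (tracked d s); first by exists [::], (s :: N ++ B').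
by exists (s :: N), B'; rewrite /= ts.
Qed.

(** One round of the comparison for each tracked symbol after the mark J; the
    hypothesis says that the tracked symbols after I reappear after J.  The text
    between the two marks begins with a tracked symbol at every round, because
    the mark I hops over the untracked ones. *)
Lemma run_ready d x A B C D E :
  (if B is s :: _ then tracked d s else false) ->
  track d D = track d B ++ E ->
  dead (opened x A (split_text B C) ++ Ready d :: map Rgt D).
Proof.
elim: D A B C => [|s D IH] A B C hB /=.
  by case: B hB => //= s B ->.
case ts: (tracked d s) => eD; last first.
  have nts : ~~ tracked d s by rewrite ts.
  rewrite (step (opened x A (split_text B C)) (map Rgt D) (move_skip nts)) /=.
  by have := IH A B (rcons C s) hB eD; rewrite split_text_rcons opened_rcons -catA.
case: B hB eD => // t B ht; rewrite {2}/track /= ht => -[et eD]; rewrite -{}et {ht}.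
rewrite (step (opened x A (split_text (s :: B) C)) (map Rgt D) (move_pick ts)) /=.
rewrite /opened -catA /= -cat_cons -cat_rcons.
rewrite (sweep_carry d s _ (split_text (s :: B) C)) /=.
rewrite cat_rcons.
rewrite (step (Open x :: map Lft A)
  (map rcell (split_text B C) ++ Held s :: map Rgt D) (move_match ts)).
have [N [B' [eB aN hB']]] := untracked_prefix d B.
rewrite {}eB in eD *.
rewrite (_ : _ ++ _ = (Open x :: map Lft (rcons A s)) ++ MarkI :: Back d ::
    map Rgt N ++ (map rcell (split_text B' C) ++ Held s :: map Rgt D)); last first.
  by rewrite /split_text !map_cat map_rcell_Some map_rcons -!cats1 -?catA /= -?catA.
rewrite (sweep_hop _ _ aN).
case: B' hB' eD => [|t' B'] hB' eD.
  rewrite (_ : _ ++ _ = (Open x :: map Lft (rcons A s ++ N)) ++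
    [:: MarkI; Back d; MarkJ false] ++ map Rgt C ++ Held s :: map Rgt D); last first.
    by rewrite map_cat /= -?catA /split_text /= map_rcell_Some.
  exact: dead_none (none_square d).
rewrite (_ : _ ++ _ = opened x (rcons A s ++ N) [::] ++ Back d ::
    map rcell (split_text (t' :: B') C) ++ Held s :: map Rgt D); last first.
  by rewrite /opened map_cat /= -?catA /= -?catA.
rewrite (sweep_back d (opened x (rcons A s ++ N) [::]) (split_text (t' :: B') C)).
rewrite (_ : _ ++ _ = opened x (rcons A s ++ N) (split_text (t' :: B') C) ++
    [::] ++ Back d :: [:: Held s] ++ map Rgt D); last first.
  by rewrite /opened -?catA /= -?catA.
rewrite (step _ (map Rgt D) (move_done ts)).
have := IH (rcons A s ++ N) (t' :: B') (rcons C s) hB'.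
rewrite split_text_rcons opened_rcons -catA; apply.
by rewrite eD filter_cat (@eq_in_filter _ _ pred0) ?filter_pred0 // => z /(allP aN) /negbTE.
Qed.

(** The marks are dropped at the beginning and at the end of the first copy,
    after shifting its untracked prefix to [T1]. *)
Lemma run_square d x T1 Ta Tb T2 :
  track d Ta = track d Tb -> track d Ta <> [::] ->
  dead (Root x :: map Rgt (T1 ++ Ta ++ Tb ++ T2)).
Proof.
have [N [B [-> aN hB]]] := untracked_prefix d Ta; move=> eT.
have tB : track d (N ++ B) = track d B.
  by rewrite /track filter_cat (@eq_in_filter _ _ pred0) ?filter_pred0 // => z /(allP aN) /negbTE.
rewrite tB => nB; set A := T1 ++ N.
have -> : map Rgt (T1 ++ (N ++ B) ++ Tb ++ T2) =
    map Rgt A ++ map Rgt B ++ map Rgt (Tb ++ T2).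
  by rewrite /A !map_cat -?catA.
rewrite run_home -cat_cons; set r := map Rgt (Tb ++ T2).
rewrite (step (Open x :: map Lft A) (map Rgt B ++ r) (move_mark d)).
rewrite (_ : _ ++ _ = opened x A [::] ++ Place d :: map Rgt B ++ r); last first.
  by rewrite /opened /= -?catA.
rewrite sweep_place.
rewrite (_ : _ ++ _ = opened x A (map Some B) ++ [::] ++ Place d :: [::] ++ r); last first.
  by rewrite /opened map_lcell_Some /= -?catA.
rewrite (step (opened x A (map Some B)) r (move_start d)).
rewrite (_ : _ ++ _ = opened x A (split_text B [::]) ++ Ready d :: r); last first.
  by rewrite /opened /split_text map_cat /= -?catA /= -?catA.
apply: (@run_ready _ _ _ _ _ _ (track d T2)); first by case: (B) hB nB => // _ [].
by rewrite -tB eT /track filter_cat.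
Qed.


(** * Bringing a zone back to its initial state *)

(** The last mark on the left of a head decides in which phase the head is. *)
Lemma left_split l : all is_left l ->
  (exists A, l = map Lft A) \/
  exists l1 m A, [/\ l = l1 ++ m :: map Lft A, all is_left l1 &
                     m = MarkI \/ m = MarkJ true].
Proof.
elim/last_ind: l => [|l c IH]; first by left; exists [::].
rewrite all_rcons => /andP [lc /IH [[A ->]|[l1 [m [A [-> al hm]]]]]].
  case: c lc => // [s||[] //] _; first by left; exists (rcons A s); rewrite map_rcons.
  - by right; exists (map Lft A), MarkI, [::]; rewrite cats1 all_map; split; [|apply/allP|left].
  - by right; exists (map Lft A), (MarkJ true), [::]; rewrite cats1 all_map; split; [|apply/allP|right].
case: c lc => // [s||[] //] _; right.
- by exists l1, m, (rcons A s); rewrite map_rcons -rcons_cons rcons_cat.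
- exists (l1 ++ m :: map Lft A), MarkI, [::]; rewrite cats1; split; last by left.
    by [].
  by rewrite all_cat al /= all_map; apply/andP; split; [case: hm => ->|apply/allP].
- exists (l1 ++ m :: map Lft A), (MarkJ true), [::]; rewrite cats1; split; last by right.
    by [].
  by rewrite all_cat al /= all_map; apply/andP; split; [case: hm => ->|apply/allP].
Qed.

Lemma mark_split l : all is_left l ->
  (exists u, l = map lcell u) \/
  exists l1 u, l = l1 ++ MarkI :: map lcell u /\ all is_left l1.
Proof.
elim/last_ind: l => [|l c IH]; first by left; exists [::].
rewrite all_rcons => /andP [lc al]; have [u|] := IH al.
  case: u => u eu; case: c lc => // [s||[] //] _.
  - by left; exists (rcons u (Some s)); rewrite map_rcons eu.
  - by right; exists l, [::]; rewrite cats1.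
  - by left; exists (rcons u None); rewrite map_rcons eu.
move=> [l1 [u [el al1]]]; right; case: c lc => // [s||[] //] _.
- by exists l1, (rcons u (Some s)); rewrite el map_rcons -rcons_cons -rcons_cat.
- by exists l, [::]; rewrite cats1.
- by exists l1, (rcons u None); rewrite el map_rcons -rcons_cons -rcons_cat.
Qed.

Lemma untracked_split d l : all is_left l -> exists N,
  all (predC (tracked d)) N /\
  (l = map Lft N \/ exists l' c, [/\ l = l' ++ c :: map Lft N, all is_left l' &
     (exists2 s, c = Lft s & tracked d s) \/ c = MarkI \/ c = MarkJ true]).
Proof.
elim/last_ind: l => [|l c IH]; first by exists [::]; split=> //; left.
rewrite all_rcons => /andP [lc al].
case cE: (if c is Lft s then ~~ tracked d s else false).
  case: c cE {lc} => // s ns; have [N [aN hN]] := IH al.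
  exists (rcons N s); rewrite all_rcons /= ns; split=> //.
  case: hN => [->|[l' [c [-> al' hc]]]]; first by left; rewrite map_rcons.
  by right; exists l', c; rewrite map_rcons -rcons_cons rcons_cat.
exists [::]; split=> //; right; exists l, c; rewrite cats1; split=> //.
case: c lc cE => // [s _ /negbFE ts||[] // _ _]; first by left; exists s.
  by right; left.
by right; right.
Qed.

Section RollBack.

Variables (x : colour).

(** If the initial states of a zone are 0, then so is every word that begins
    with [Root x] or [Open x] and ends at a front: the machine is run backwards,
    and each head can either be moved back or has next to it a cell that makes a
    forbidden word. *)
Definition homes : Prop := forall T, dead (Root x :: map Rgt T).
Hypothesis home : homes.
Variables (g : colour) (q : seq letter).
Hypothesis QE : Q = Front g :: q.

Lemma right_split r : (exists T, r = map Rgt T) \/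
  exists T e r', r = map Rgt T ++ e :: r' /\ forall s, e <> Rgt s.
Proof.
elim: r => [|c r IH]; first by left; exists [::].
case cE: (if c is Rgt _ then true else false); last first.
  by right; exists [::], c, r; split=> // s ec; rewrite ec in cE.
case: c cE => // s _; case: IH => [[T ->]|[T [e [r' [-> he]]]]].
  by left; exists (s :: T).
by right; exists (s :: T), e, r'.
Qed.

Lemma dead_scan A r : dead (Open x :: map Lft A ++ Scan :: r).
Proof.
have [[T ->]|[T [e [r' [-> he]]]]] := right_split r; rewrite -cat_cons.
  rewrite -[map Rgt T]cats0 sweep_scan cat_cons catA -map_cat -run_home cats0.
  exact: home.
rewrite sweep_scan catA (_ : Scan :: _ = [:: Scan; e] ++ r') //.
exact: dead_none (none_after_scan he).
Qed.

Definition mark m := m = MarkI \/ m = MarkJ true.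

Lemma dead_scan_left l r : all is_left l -> dead (Open x :: l ++ Scan :: r).
Proof.
move=> /left_split [[A ->]|[l1 [m [A [-> _ hm]]]]]; first exact: dead_scan.
rewrite -catA cat_cons -cat_rcons -cat_cons -sweep_scan.
rewrite -rcons_cons cat_rcons (_ : m :: _ = [:: m; Scan] ++ (map Rgt A ++ r)) //.
apply: dead_none => //; apply: none_before_scan.
by case: hm => ->; [left | right; exists true].
Qed.

Lemma dead_place d l r : all is_left l -> dead (Open x :: l ++ Place d :: r).
Proof.
move=> /left_split [[A ->]|[l1 [m [A [-> al hm]]]]].
  rewrite -[_ :: _ ++ _]/([:: Open x] ++ _) -sweep_place.
  rewrite -[_ ++ _]/([::] ++ [:: Open x; Place d] ++ _).
  by apply: dead_none => //; apply: none_before_place; right; exists x.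
rewrite -catA cat_cons -cat_rcons -cat_cons -sweep_place -rcons_cons cat_rcons.
case: hm => ->; last first.
  rewrite (_ : MarkJ true :: _ = [:: MarkJ true; Place d] ++ (map Rgt A ++ r)) //.
  by apply: dead_none => //; apply: none_before_place; left.
rewrite -(step (Open x :: l1) (map Rgt A ++ r) (move_mark d)).
exact: dead_scan_left.
Qed.

(** Undoing a round of the comparison goes from [Ready] to [Back], then to
    [Carry], then to the previous [Ready], with a shorter text on its left: the
    length of the part on the left decreases with each round, although it changes
    during the round. *)
Definition ready_below d n : Prop := forall l r,
  all is_left l -> size l < n -> dead (Open x :: l ++ Ready d :: r).

Lemma right_cells r : exists v r', r = map rcell v ++ r' /\
  if r' is c :: _ then forall o, c <> rcell o else True.
Proof.
elim: r => [|c r [v [r' [-> hr]]]]; first by exists [::], [::].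
have [[o ->]|no] := pselect (exists o, c = rcell o).
  by exists (o :: v), r'.
by exists [::], (c :: map rcell v ++ r'); split=> // o co; apply: no; exists o.
Qed.

Lemma dead_carry d s n l v r : ready_below d n -> all is_left l ->
  size l + size v < n -> (if r is c :: _ then forall o, c <> rcell o else True) ->
  dead (Open x :: l ++ Carry d s :: map rcell v ++ r).
Proof.
move=> H al le hr; case ts: (tracked d s); last first.
  rewrite -cat_cons -[Carry d s :: _]/([:: Carry d s] ++ _).
  by apply: dead_none => //; apply: none_untracked_carry; rewrite ts.
rewrite -cat_cons -sweep_carry catA; case: r hr => [|c r] hr.
  rewrite /dead QE map_cat -!catA catA.
  rewrite -[_ ++ Front g :: q]/([:: Cell (Carry d s); Front g] ++ q).
  by apply: zero_none => //; exact: none_carry_end.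
have [ec|nc] := pselect (c = Held s).
  rewrite ec -(step ((Open x :: l) ++ map lcell v) r (move_pick ts)) /= -catA -cat_cons catA.
  apply: H; first by rewrite all_cat al all_map; apply/allP=> [[]].
  by rewrite size_cat size_map.
rewrite (_ : Carry d s :: _ = [:: Carry d s; c] ++ r) //.
apply: dead_none => //; apply: none_after_carry => // [t|] ct.
  exact: (hr (Some t)).
exact: (hr None).
Qed.

Lemma dead_back d n l v r : ready_below d n -> all is_left l ->
  size l + size v < n -> (if r is c :: _ then forall o, c <> rcell o else True) ->
  dead (Open x :: l ++ Back d :: map rcell v ++ r).
Proof.
move=> H /mark_split [[u ->] _ _|[l1 [u [-> al]]]].
  rewrite -[_ :: _ ++ _]/([:: Open x] ++ _) -sweep_back.
  rewrite -[_ ++ _]/([::] ++ [:: Open x; Back d] ++ _).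
  by apply: dead_none => //; exact: none_open_back.
rewrite size_cat /= size_map => le hr.
rewrite -catA cat_cons -cat_rcons -cat_cons -sweep_back -rcons_cons cat_rcons.
have [N [aN [el|[l' [c [el al' hc]]]]]] := untracked_split d al; rewrite el.
  rewrite -[_ :: _]/([:: Open x] ++ _) -catA -(sweep_hop _ _ aN).
  rewrite -[_ ++ _]/([::] ++ [:: Open x; MarkI; Back d] ++ _).
  by apply: dead_none => //; apply: none_mark_back; right; right; exists x.
rewrite (_ : (_ :: _) ++ _ = rcons (Open x :: l') c ++ map Lft N ++ MarkI :: Back d ::
    map rcell u ++ map rcell v ++ r); last by rewrite /= -catA cat_rcons.
rewrite -sweep_hop // cat_rcons.
have nm : (exists b, c = MarkJ b) \/ c = MarkI -> dead ((Open x :: l') ++ c :: MarkI ::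
    Back d :: map Rgt N ++ map rcell u ++ map rcell v ++ r).
  move=> hm; rewrite -[c :: _]/([:: c; MarkI; Back d] ++ _).
  apply: dead_none => //; apply: none_mark_back.
  by case: hm => hm; [left | right; left].
case: hc => [[s -> ts]|[mI|mJ]]; last 2 first.
- by apply: nm; right.
- by apply: nm; left; exists true.
have /= <- := step (Open x :: l') (map Rgt N ++ map rcell u ++ map rcell v ++ r) (move_match ts).
have := @dead_carry d s n (rcons l' MarkI) (Some s :: map Some N ++ u ++ v) r.
rewrite cat_rcons /= !map_cat map_rcell_Some -!catA; apply=> //.
  by rewrite all_rcons.
by move: le; rewrite el size_rcons ?size_cat /= ?size_cat ?size_map ?size_cat; lia.
Qed.

Lemma dead_ready d l r : all is_left l -> dead (Open x :: l ++ Ready d :: r).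
Proof.
have [n lt_n] := ubnP (size l); elim: n l r lt_n => // n IH l r lt_n al.
have below : ready_below d n by move=> l' r' al' lt'; exact: IH.
have [N [aN [el|[l' [c [el al' hc]]]]]] := untracked_split d al; rewrite el.
  rewrite -[_ :: _]/([:: Open x] ++ _) -(sweep_ready _ _ aN).
  rewrite -[_ ++ _]/([::] ++ [:: Open x; Ready d] ++ _).
  by apply: dead_none => //; apply: none_before_ready; right; exists x.
rewrite -catA cat_cons -cat_rcons -cat_cons -sweep_ready // -rcons_cons cat_rcons.
case: hc => [[s -> ts]|[->|->]].
- rewrite -(step (Open x :: l') (map Rgt N ++ r) (move_done ts)).
  apply: (@dead_back d n l' [::] (Held s :: map Rgt N ++ r)) => //; last by case.
  by move: lt_n; rewrite el size_cat /= addn0; lia.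
- rewrite -[MarkI :: _]/([:: MarkI; Ready d] ++ _).
  by apply: dead_none => //; apply: none_before_ready; left.
- rewrite -(step (Open x :: l') (map Rgt N ++ r) (move_start d)).
  exact: dead_place.
Qed.

(** The first cell after [Open x] that does not show a head on its right must be
    a head itself, and in each phase the head can be brought home. *)
Lemma dead_open w : dead (Open x :: w).
Proof.
have [l [r [-> al hr]]] : exists l r, [/\ w = l ++ r, all is_left l &
    if r is c :: _ then ~~ is_left c else true].
  elim: w => [|c w [l [r [-> al hr]]]]; first by exists [::], [::].
  case lc: (is_left c); first by exists (c :: l), r; rewrite /= lc.
  by exists [::], (c :: l ++ r); rewrite /= lc.
have [k [e [ek he]]] : exists k e, Open x :: l = rcons k e /\ is_left e || is_open e.
  case/lastP: (l) al => [|k e]; first by exists [::], (Open x).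
  by rewrite all_rcons => /andP [le _]; exists (Open x :: k), e; rewrite le.
have kill c r' : r = c :: r' -> ~~ is_head c || (if c is Root _ then true else false) ->
    dead (Open x :: l ++ r).
  move=> er hc; rewrite er in hr *; rewrite -cat_cons ek cat_rcons.
  rewrite -[e :: _]/([:: e; c] ++ r').
  by apply: dead_none => //; exact: none_after_left.
case: r hr kill => [|c r] hr kill.
  rewrite cats0 /dead QE ek map_rcons cat_rcons catA.
  rewrite -[Cell e :: _]/([:: Cell e; Front g] ++ q).
  by apply: zero_none => //; exact: none_left_end.
have [v [r' [er hr']]] := right_cells r.
case: c hr kill => [y|y|s|s|s||b||d|d|d s|d] hr kill; try by apply: kill.
- exact: dead_scan_left.
- exact: dead_place.
- exact: dead_ready.
- rewrite er; apply: (@dead_carry d s (size l + size v).+1) => // l' r1 al' _.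
  exact: dead_ready.
- rewrite er; apply: (@dead_back d (size l + size v).+1) => // l' r1 al' _.
  exact: dead_ready.
Qed.

Lemma dead_root w : dead (Root x :: w).
Proof.
have /= -> := step [::] w (move_open x); exact: dead_open.
Qed.

End RollBack.
End Machine.

(** * Zones at home *)

Lemma zero_eat x U p q :
  zero (p ++ Front x :: map Cell U ++ q) <->
  zero (p ++ map Cell (map Rgt (encode U)) ++ Front x :: q).
Proof.
elim: U p => //= e U IH p.
have := @zero_some _ _ p (map Cell U ++ q) _ _ (valid_eat x e).
rewrite /= => ->.
- have := IH (p ++ map Cell (map Rgt (code e))).
  by rewrite /encode /= !map_cat -?catA /= -?catA.
- by [].
- by rewrite size_cat !size_map addn1; case/andP: (size_code e).
Qed.

(** The text of a head at rest is read from its right end: the front gives back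
    one cell after the other, and a text that is not a code, or a root of a
    different colour, is 0. *)
Lemma homes_eat P g q y :
  (forall U, zero (P ++ [:: Cell (Root g), Front g & map Cell U ++ q])) ->
  homes P (Front g :: q) y.
Proof.
move=> H T; have [n lt_n] := ubnP (size T).
elim: n T q lt_n H => // n IH T q lt_n H.
have [[e [w eT]]|no] := pselect (exists e w, T = w ++ code e).
  rewrite (_ : dead _ _ _ = zero ((P ++ Cell (Root y) :: map Cell (map Rgt w)) ++
      map Cell (map Rgt (encode [:: e])) ++ Front g :: q)); last first.
    by rewrite /dead eT /encode /= cats0 !map_cat -?catA /= -?catA.
  rewrite -zero_eat -catA.
  apply: (IH w (Cell e :: q)) => [|U].
    by move: lt_n; rewrite eT size_cat; have := size_code e; lia.
  by have := H (rcons U e); rewrite map_rcons cat_rcons.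
have nw e w : T <> w ++ code e by move=> eT; apply: no; exists e, w.
have [T0|T_n0] := pselect (T = [::]).
  rewrite /dead T0 /=; have [<-|ne] := pselect (g = y).
    exact: (H [::]).
  rewrite -[_ :: _]/([:: Cell (Root y); Front g] ++ q).
  by apply: zero_none => //; apply: none_wrong_home => yg; case: ne.
have [le3|gt3] := leqP (size T) 3.
  rewrite /dead -[Front g :: q]/([:: Front g] ++ q) [map Cell _ ++ _]catA.
  apply: zero_none; last exact: none_root_short.
  by rewrite size_cat /= !size_map addn1.
have [T1 [T2 [eT sT2]]] : exists T1 T2, T = T1 ++ T2 /\ size T2 = 4.
  exists (take (size T - 4) T), (drop (size T - 4) T).
  rewrite cat_take_drop size_drop subKn; first by split.
  exact: gt3.
rewrite (_ : dead _ _ _ = zero ((P ++ map Cell (Root y :: map Rgt T1)) ++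
    (map Cell (map Rgt T2) ++ [:: Front g]) ++ q)); last first.
  by rewrite /dead eT !map_cons !map_cat -!catA /= -!catA.
apply: zero_none; first by rewrite size_cat !size_map sT2.
apply: none_tail => [|e w eT2]; first by rewrite sT2.
by apply: (nw e (T1 ++ w)); rewrite eT eT2 catA.
Qed.

(** A zone in any state can be taken for one at rest with an empty text, at the
    price of unknown cells [U'] behind its front. *)
Lemma zero_zone P U g q :
  (forall U', zero (P ++ [:: Cell (Root g), Front g & map Cell U' ++ q])) ->
  (exists y w, U = Root y :: w \/ U = Open y :: w) ->
  zero (P ++ map Cell U ++ Front g :: q).
Proof.
move=> H [y [w [->|->]]].
- by apply: (@dead_root P (Front g :: q) y _ g q erefl w); exact: homes_eat.
- by apply: (@dead_open P (Front g :: q) y _ g q erefl w); exact: homes_eat.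
Qed.

Definition at_home (gs : seq colour) : seq letter :=
  flatten [seq [:: Cell (Root g); Front g] | g <- gs].

Definition zones (zs : seq (seq cell * colour)) : seq letter :=
  flatten [seq rcons (map Cell z.1) (Front z.2) | z <- zs].

Lemma at_home_rcons gs g :
  at_home (rcons gs g) = at_home gs ++ [:: Cell (Root g); Front g].
Proof. by rewrite /at_home map_rcons -cats1 flatten_cat. Qed.

(** The cells that a front gives back when its zone is brought home are added
    to the next zone, whence the arbitrary [U]; those of the last zone go to the
    arbitrary end of the word. *)
Lemma zero_zones x gs U zs q :
  (forall w, zero (at_home (x :: gs ++ map snd zs) ++ w)) ->
  zero (at_home (x :: gs) ++ map Cell U ++ zones zs ++ q).
Proof.
elim: zs gs U => [|[U2 g] zs IH] gs U H; first by have := H (map Cell U ++ q); rewrite /= cats0.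
have -> : map Cell U ++ zones ((U2, g) :: zs) ++ q =
    map Cell (U ++ U2) ++ Front g :: zones zs ++ q.
  by rewrite /zones /= !map_cat -cats1 -!catA.
set V := U ++ U2.
case vE: (if V is c :: _ then if c is (Root _ | Open _) then true else false else false).
  apply: (@zero_zone (at_home (x :: gs)) V g (zones zs ++ q)) => [U'|].
    have := IH (rcons gs g) U'; rewrite cat_rcons => /(_ H).
    by rewrite -rcons_cons at_home_rcons -!catA /=.
  by case: V vE => // c w; case: c => // y _; exists y, w; [left | right].
have [gs' [y ey]] : exists gs' y, x :: gs = rcons gs' y.
  by case/lastP: (gs) => [|gs' y]; [exists [::], x | exists (x :: gs'), y].
rewrite ey at_home_rcons -catA.
case: V vE => [|c V] vE.
  rewrite -[_ ++ map Cell [::] ++ _]/([:: Cell (Root y); Front y; Front g] ++ _).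
  by apply: zero_none => //; exact: none_after_home.
rewrite -[_ ++ map Cell (c :: V) ++ _]/([:: Cell (Root y); Front y; Cell c] ++ _).
by apply: zero_none => //; apply: none_after_home; case: c vE.
Qed.

(** * Squares are zero *)

Definition plain (a : letter) : bool :=
  match a with Front _ | Cell _ => true | _ => false end.

Definition fronts : seq letter -> seq colour :=
  pmap (fun a => if a is Front x then Some x else None).

Definition letter_hats : seq letter -> seq colour :=
  pmap (fun a => if a is Cell e then hat e else None).

Lemma plain_zones R : all plain R -> exists zs U,
  R = zones zs ++ map Cell U /\ map snd zs = fronts R.
Proof.
elim: R => [|a R IH] /=; first by exists [::], [::].
case: a => // [x|e] /IH [zs [U [-> <-]]].
  by exists (([::], x) :: zs), U.
case: zs => [|[V y] zs]; first by exists [::], (e :: U).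
by exists ((e :: V, y) :: zs), U.
Qed.

Lemma hats_Rgt T : hats (map Rgt T) = pmap symbol_hat T.
Proof. by elim: T => //= [[x|z] T] /= ->. Qed.

(** [V] depends on [U] only, so a repetition of [U] becomes one of [V]. *)
Lemma zero_fronts_eat fs U : exists V,
  [/\ hats V = hats U, U <> [::] -> V <> [::] & forall p q,
     zero (p ++ map Front fs ++ map Cell U ++ q) <->
     zero (p ++ map Cell V ++ map Front fs ++ q)].
Proof.
elim: fs => [|x fs [V [hV nV zV]]]; first by exists U.
exists (map Rgt (encode V)); split.
- by rewrite hats_Rgt encode_hats.
- move=> /nV; case: V {hV nV zV} => // e V _; have := size_code e.
  by rewrite /encode /=; case: (code e).
move=> p q; have := zV (rcons p (Front x)) q; rewrite !cat_rcons => -> /=.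
exact: zero_eat.
Qed.

(** A front replaces the cells that it passes by their codes, whose hats are the
    same; so all fronts of a word can be pushed to its right end without changing
    the colours that its cells carry. *)
Lemma zero_push R : all plain R -> exists V fs,
  hats V = letter_hats R /\ forall p q,
     zero (p ++ R ++ q) <-> zero (p ++ map Cell V ++ map Front fs ++ q).
Proof.
elim: R => [|a R IH]; first by exists [::], [::].
case: a => //= [x|e] /IH [V [fs [hV zV]]].
  have [V' [hV' _ zV']] := zero_fronts_eat [:: x] V.
  exists V', (x :: fs); split=> [|p q]; first by rewrite hV'.
  have := zV (rcons p (Front x)) q; rewrite !cat_rcons => ->.
  exact: zV'.
exists (e :: V), fs; rewrite /hats /= -/(hats V) hV; split=> // p q.
by have := zV (rcons p (Cell e)) q; rewrite !cat_rcons.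
Qed.

Lemma track_hats T : track false T = map inl (pmap symbol_hat T).
Proof. by elim: T => //= [[x|z] T] /= ->. Qed.

Lemma pmap_split (S T : Type) (f : S -> option T) s a b :
  pmap f s = a ++ b -> exists s1 s2,
    [/\ s = s1 ++ s2, pmap f s1 = a & pmap f s2 = b].
Proof.
elim: a s => [|c a IH] s /=; first by exists [::], s.
elim: s => //= y s IHs; case fy: (f y) => [z|] /=.
  case=> ez /IH [s1 [s2 [-> <- <-]]].
  by exists (y :: s1), s2; rewrite /= fy /= ez.
by move=> /IHs [s1 [s2 [-> es1 es2]]]; exists (y :: s1), s2; rewrite /= fy /=.
Qed.

Lemma zero_repeated_text p x d U T1 Ta Tb T2 q :
  encode U = T1 ++ Ta ++ Tb ++ T2 -> track d Ta = track d Tb ->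
  track d Ta <> [::] ->
  zero (p ++ [:: Cell (Root x), Front x & map Cell U ++ q]).
Proof.
move=> eU eT nT; rewrite -cat_rcons zero_eat cat_rcons eU.
exact: (@run_square p (Front x :: q) d).
Qed.

(** Once every zone is at home, pushing the fronts to the right writes the
    colours of all the zones into the text of the first one. *)
Lemma zero_repeated_colours x a b c w :
  b <> [::] -> zero (at_home (x :: a ++ b ++ b ++ c) ++ w).
Proof.
move=> nb; set gs := a ++ b ++ b ++ c.
have pl : all plain (at_home gs) by elim: gs => //=.
have hg : letter_hats (at_home gs) = gs by elim: gs {pl} => //= y s ->.
have [V [fs [hV zV]]] := zero_push pl.
rewrite -[at_home _]/([:: Cell (Root x); Front x] ++ at_home gs) -catA zV.
rewrite hg -encode_hats in hV.
have [T1 [T' [eT _ /pmap_split [Ta [T'' [eT' ha /pmap_split [Tb [T2 [eT'' hb _]]]]]]]]] := pmap_split hV.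
apply: (@zero_repeated_text [::] x false V T1 Ta Tb T2).
- by rewrite eT eT' eT''.
- by rewrite !track_hats ha hb.
- by rewrite track_hats ha; case: (b) nb.
Qed.

(** The fronts of [X] pass over both copies of [U] and change them in the same
    way, and the first front codes the result. *)
Lemma zero_repeated_cells x X U q : all plain X -> U <> [::] ->
  zero ([:: Cell (Root x); Front x] ++ X ++ map Cell U ++ map Cell U ++ q).
Proof.
move=> /zero_push [V [fs [_ zV]]] nU; rewrite zV.
have [W [_ /(_ nU) nW zW]] := zero_fronts_eat fs U.
have := zW ([:: Cell (Root x); Front x] ++ map Cell V) (map Cell U ++ q).
rewrite -!catA => ->; rewrite catA catA.
have := zW ([:: Cell (Root x); Front x] ++ map Cell V ++ map Cell W) q.
rewrite -!catA => -> /=.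
rewrite (_ : map Cell V ++ _ = map Cell (V ++ W ++ W) ++ map Front fs ++ q); last first.
  by rewrite !map_cat -!catA.
apply: (@zero_repeated_text [::] x true _ (encode V) (encode W) (encode W) [::]) => //.
  by rewrite !encode_cat cats0 catA.
rewrite /track (@eq_filter _ _ predT) // filter_predT.
case: W nW {zW} => // e W _; have := size_code e; rewrite /encode /=.
by case: (code e).
Qed.

(** If [Y] has fronts, the zones of the two copies of [Y] may differ in their
    states, because the cells before [Y] are not the cells at its end; only the
    fronts are known to repeat. *)
Lemma zero_plain_square x X Y q : all plain X -> all plain Y -> Y <> [::] ->
  zero ([:: Cell (Root x); Front x] ++ X ++ Y ++ Y ++ q).
Proof.
move=> pX pY nY; have [fY|fY] := pselect (fronts Y = [::]).
  have [U eU] : exists U, Y = map Cell U.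
    elim: (Y) pY fY => [|[||y|e] R IH] //=; first by exists [::].
    by move=> /IH {}IH /IH [U ->]; exists (e :: U).
  rewrite eU; apply: zero_repeated_cells => // U0.
  by apply: nY; rewrite eU U0.
have [|zs [U [eR ez]]] := @plain_zones (X ++ Y ++ Y).
  by rewrite !all_cat pX pY.
rewrite (catA Y Y) (catA X) eR -catA.
apply: (@zero_zones x [::] [::]) => w.
rewrite ez /fronts !pmap_cat -[pmap _ Y ++ _]cats0 -!catA.
exact: zero_repeated_colours.
Qed.

(** * Opening the zones *)

Definition open_zones : seq letter -> seq letter :=
  flatten \o map (fun a =>
    match a with
    | Start => [::] | Base x => [:: Cell (Root x); Front x] | _ => [:: a]
    end).

Lemma open_zones_cat V W : open_zones (V ++ W) = open_zones V ++ open_zones W.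
Proof. by rewrite /open_zones /= map_cat flatten_cat. Qed.

Lemma plain_open_zones V : all plain (open_zones V).
Proof. by elim: V => //= a V IH; rewrite /open_zones /= all_cat IH andbT; case: a. Qed.

Definition is_base a := if a is Base _ then true else false.

Lemma zero_base a b p q : a <> Start -> is_base b -> zero (p ++ a :: b :: q).
Proof.
move=> na; case: b => // x _; rewrite -[a :: _]/([:: a; Base x] ++ q).
by apply: zero_none => //; exact: none_before_base.
Qed.

Lemma zero_start b p q : ~~ is_base b -> zero (p ++ Start :: b :: q).
Proof.
move=> nb; rewrite -[Start :: _]/([:: Start; b] ++ q).
apply: zero_none => //; apply: none_after_start => x bx.
by rewrite bx in nb.
Qed.

(** [Start] not followed by a base, and a base not preceded by [Start], are
    forbidden.  A trailing [Start] has no base after it yet; the arbitrary end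
    [w] supplies it. *)
Lemma zero_open_zones V p :
  (if V is a :: _ then ~~ is_base a else true) ->
  (forall w, zero (p ++ open_zones V ++ w)) -> zero (p ++ V).
Proof.
have [n lt_n] := ubnP (size V); elim: n V lt_n p => // n IH V lt_n p.
case: V lt_n => [|a V] lt_n; first by move=> _ /(_ [::]).
have next p' a' V' : a' <> Start -> size V' < n ->
    (forall w, zero (rcons p' a' ++ open_zones V' ++ w)) -> zero (p' ++ a' :: V').
  move=> na lt_V H; rewrite -cat_rcons; case: V' lt_V H => [|b V'] lt_V H.
    exact: (H [::]).
  have [bb|nb] := boolP (is_base b); first by rewrite cat_rcons; exact: zero_base.
  by apply: IH => // w; exact: H.
case: a lt_n => [|x|x|e] lt_n //= _ H; last 2 first.
- by apply: next => // w; have := H w; rewrite cat_rcons.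
- by apply: next => // w; have := H w; rewrite cat_rcons.
case: V lt_n H => [|b V] lt_n H; first exact: (H [:: Start]).
have [|nb] := boolP (is_base b); last exact: zero_start.
case: b lt_n H => // x lt_n H _.
rewrite -[Start :: _]/([:: Start; Base x] ++ V).
rewrite (zero_some _ _ _ _ (valid_start x)) //= -cat_rcons.
apply: next => //; first by move: lt_n => /=; lia.
by move=> w; have := H w; rewrite !cat_rcons.
Qed.

Theorem zero_square X Y Z : X <> [::] -> Y <> [::] ->
  zero (Start :: X ++ Y ++ Y ++ Z).
Proof.
case: X => // a X _ nY.
have [|na] := boolP (is_base a); last by exact: (@zero_start a [::]).
case: a => // x _.
have [Y0|nY0] := pselect (open_zones Y = [::]).
  (* Then [Y] is a power of [Start], and two [Start] in a row are forbidden. *)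
  case: Y nY Y0 => [|[] Y] // _ Y0.
  case: Y Y0 => [|[] Y] // Y0.
    rewrite -cat_cons; exact: (@zero_start Start (Start :: Base x :: X)).
  rewrite -cat_cons; exact: (@zero_start Start (Start :: Base x :: X)).
apply: (@zero_open_zones (Start :: (Base x :: X) ++ Y ++ Y ++ Z) [::]) => // w.
rewrite -[_ ++ _]/([:: Cell (Root x); Front x] ++ open_zones (X ++ Y ++ Y ++ Z) ++ w).
rewrite !open_zones_cat -!catA; apply: zero_plain_square => //; exact: plain_open_zones.
Qed.

(** * Nonvanishing products *)

(** The parity of [n] and the residue modulo 4 of its odd part: a sequence on
    four colours whose repetitions are excluded by the 2-adic valuation of their
    period. *)
Definition ruler n : colour := (odd n, odd (n %/ 2 ^ logn 2 n)./2).

Lemma ruler_odd_part k m : odd m -> (ruler (2 ^ k * m)).2 = odd m./2.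
Proof.
move=> om; rewrite /ruler /= lognM ?expn_gt0 //; last by case: (m) om.
by rewrite pfactorK // logn_coprime ?coprime2n // addn0 mulKn ?expn_gt0.
Qed.

(** An odd period changes the parity of the index.  A period 2^(k+1) m with m odd
    is at least as long as the distance between two odd multiples of 2^k, so the
    window contains such an index, and adding the period to it adds 2 m to its
    odd part, which changes the residue modulo 4. *)
Lemma ruler_squarefree N : squarefree (mkseq (fun i => ruler i.+1) N).
Proof.
apply: (@squarefree_nth _ (false, false)) => i n n_gt0; rewrite size_mkseq => le_N.
suff [j [lt_j le_j ne]] : exists j, [/\ i < j, j <= i + n & ruler j <> ruler (j + n)].
  exists (j - i.+1); first by lia.
  rewrite !nth_mkseq; try lia.
  have -> : (i + (j - i.+1)).+1 = j by lia.
  by have -> : (i + n + (j - i.+1)).+1 = j + n by lia.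
have [on|en] := boolP (odd n).
  exists i.+1; split; try lia; move=> /(congr1 fst) /=.
  by rewrite !oddD on; case: (odd i).
have [m om nE] := pfactor_coprime (isT : prime 2) n_gt0.
rewrite coprime2n in om.
have : 0 < logn 2 n by rewrite logn_gt0 mem_primes n_gt0 dvdn2 en.
case: (logn 2 n) nE => // k nE _.
pose q := 2 ^ k; have q0 : 0 < q by rewrite expn_gt0.
have nq : n = m * (2 * q) by rewrite nE expnS.
pose s := (i + q) %/ (2 * q); exists (q * (2 * s).+1).
have sE := divn_eq (i + q) (2 * q); have := ltn_pmod (i + q) (_ : 0 < 2 * q).
rewrite muln_gt0 q0 => /(_ isT) lt_r; rewrite -/s in sE.
have m0 : 0 < m by case: (m) om.
have le_n : 2 * q <= n by rewrite nq leq_pmull.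
split; try by nia.
have -> : q * (2 * s).+1 + n = q * (2 * (s + m)).+1 by rewrite nq; nia.
move=> /(congr1 snd); rewrite !ruler_odd_part /= ?oddM //.
by rewrite !mul2n !uphalf_double oddD om; case: (odd s).
Qed.

Definition bases : seq colour -> seq letter :=
  flatten \o map (fun x => [:: Start; Base x]).

Lemma legit_bases xs : legit xs (bases xs).
Proof. by elim: xs => [|x xs IH]; [exact: legit_nil | exact: legit_base]. Qed.

Lemma bases_rcons xs x : bases (rcons xs x) = bases xs ++ [:: Start; Base x].
Proof. by rewrite /bases /= map_rcons -cats1 flatten_cat. Qed.

Local Open Scope group_scope.

Local Notation squares_semigroup := (presented squares : semigroup0Type).
Local Notation start := (@gen squares Start : squares_semigroup).

Definition principal : set squares_semigroup :=
  [set start * h | h in [set: squares_semigroup]]%classic.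

Lemma principal_right : right_ideal principal.
Proof.
split; first by exists szero; rewrite ?mulg_zero.
move=> _ h [k _ <-]; exists (k * h) => //.
by rewrite mulgA.
Qed.

Lemma power_bases xs x : exists2 w : word letter, letters w = bases (x :: xs) &
  iter (size xs) (fun J => set_mulg J principal) principal
    (@eval squares (Some w)).
Proof.
have one y : principal (@eval squares
    (Some (word_cat (letter_word Start) (letter_word (Base y))))).
  exists (@gen squares (Base y)) => //.
  exact: (@evalM squares).
elim/last_ind: xs => [|xs y [w ew Iw]]; first by eexists; [|exact: one].
rewrite size_rcons /=; eexists (word_cat w _); last first.
  exists (@eval squares (Some w)); first exact: Iw.
  by eexists; [exact: (one y) | exact: (@evalM squares)].
by rewrite -rcons_cons bases_rcons -ew.
Qed.

Lemma principal_not_nilpotent : ~ nilpotent principal.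
Proof.
move=> [k]; have := @ruler_squarefree k.+1; have := size_mkseq (fun i => ruler i.+1) k.+1.
case: (mkseq _ _) => // x xs [<-] sq e.
have [w ew] := power_bases xs x; rewrite e => /evalP /pres_eq_legit.
by move=> /(_ _ sq [::] [::]) [+ _]; apply; rewrite /= cats0 ew; exact: legit_bases.
Qed.

Lemma eval_cat (u v : word letter) :
  (@eval squares (Some u) : squares_semigroup) * @eval squares (Some v) =
  @eval squares (Some (word_cat u v)).
Proof. exact: (@evalM squares). Qed.

Lemma principal_square (A : squares_semigroup) :
  (exists X Y Z : squares_semigroup, A = X * Y * Y * Z) -> start * A = szero.
Proof.
move=> [X [Y [Z ->]]].
rewrite -[X]eval_repr -[Y]eval_repr -[Z]eval_repr.
case: (repr X) => [x|]; last
  by rewrite !(@zero_mulg squares_semigroup) (@mulg_zero squares_semigroup).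
case: (repr Y) => [y|]; last
  by rewrite !((@zero_mulg squares_semigroup), (@mulg_zero squares_semigroup)).
case: (repr Z) => [z|]; last by rewrite !(@mulg_zero squares_semigroup).
rewrite /gen !eval_cat; apply/evalP.
have [|//|u eu u0] := @zero_square x y z; first by case: (x) => [[]].
  by case: (y) => [[]].
rewrite (_ : word_cat _ _ = u) //; apply: letters_inj.
by rewrite eu /= -!catA.
Qed.

Theorem theorem1 :
  exists (P : presentation) (l : alphabet P),
    let H : semigroup0Type := presented P in
    let L : H := gen l in
    (exists I : set H,
        [/\ I = [set L * h | h in [set: H]]%classic,
            right_ideal I & ~ nilpotent I])
    /\ (forall A : H,
          (exists X Y Z : H, A = X * Y * Y * Z) -> L * A = szero).
Proof.
exists squares, Start; split; last exact: principal_square.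
exists principal; split=> //; first exact: principal_right.
exact: principal_not_nilpotent.
Qed.
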